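(* Let $\lambda>0$, let $N\ge 1$ be an integer, and let $p_0(0),\dots,p_N(0)$ be real numbers with $\sum_{n=0}^N p_n(0)=1$ and $p_N(0)\neq 0$ such that $$p(x,0)=\lambda\sum_{n=0}^N p_n(0)\,\frac{(\lambda x)^n}{n!}\,e^{-\lambda x},\qquad x>0,$$ is a probability density on $(0,\infty)$ (that is, it is nonnegative). Let $p(x,\tau)$, $\tau\ge 0$, be the solution with this initial condition of $$\frac{\partial p(x,\tau)}{\partial \tau}=-p(x,\tau)+2\int_0^\infty p(y,\tau)\,p(x+y,\tau)\,dy .$$ Then for all $\tau\ge 0$ the solution retains the form $$p(x,\tau)=\lambda\sum_{n=0}^N p_n(\tau)\,\frac{(\lambda x)^n}{n!}\,e^{-\lambda x}$$ with real coefficients $p_n(\tau)$ satisfying $\sum_{n=0}^N p_n(\tau)=1$. Moreover, for every $1\le n\le N$, $$p_n(\tau)\simeq \frac{N!}{(N-n)!}\,2^n\,\tau^{-n}\qquad(\tau\to\infty).$$ Consequently $p(x,\tau)\to\lambda e^{-\lambda x}$ as $\tau\to\infty$, and the mean $\mathbb{E}(x)=\int_0^\infty x\,p(x,\tau)\,dx$ satisfies $$\mathbb{E}(x)-\lambda^{-1}\simeq 2N\lambda^{-1}\tau^{-1}\simeq 2N\lambda^{-1}(\ln t)^{-1},$$ where $\tau=\ln(1+t)$ and $t\to\infty$.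
   Context: The notation $f(\tau)\simeq g(\tau)$ as $\tau\to\infty$ means $f(\tau)/g(\tau)\to 1$. A solution of the evolution equation is understood as a continuously differentiable curve $\tau\mapsto p(\cdot,\tau)$ in $L^1(0,\infty)$, defined for $\tau\ge 0$, with values in probability densities. The limit $p(x,\tau)\to\lambda e^{-\lambda x}$ is for each $x>0$. The variable $t\ge 0$ is the original time of the process and $\tau=\ln(1+t)$ is the rescaled time. *)

(* Defs.v *)
From HB Require Import structures.
From mathcomp Require Import all_boot all_order all_algebra.
From mathcomp Require Import all_classical all_reals all_analysis.

Set Implicit Arguments.
Unset Strict Implicit.
Unset Printing Implicit Defensive.

Import Order.TTheory GRing.Theory Num.Theory.
Import numFieldNormedType.Exports.

Local Open Scope classical_set_scope.
Local Open Scope ring_scope.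

Definition half_line (R : realType) : set R := `]0, +oo[%classic.
Arguments half_line R : clear implicits.

(* Elements of L^1(0,oo) are represented by functions R -> R, of which only the
   restriction to half_line matters, and only up to a null set. *)
Definition in_L1 (R : realType) (f : R -> R) : Prop :=
  (@lebesgue_measure R).-integrable (half_line R) (EFin \o f).

Definition eq_L1 (R : realType) (f g : R -> R) : Prop :=
  {ae (@lebesgue_measure R), forall x, half_line R x -> f x = g x}.

Definition L1_norm (R : realType) (f : R -> R) : \bar R :=
  (\int[@lebesgue_measure R]_(x in half_line R) `|f x|%:E)%E.

Definition prob_density (R : realType) (f : R -> R) : Prop :=
  [/\ in_L1 f,
      {ae (@lebesgue_measure R), forall x, half_line R x -> 0 <= f x} &
      (\int[@lebesgue_measure R]_(x in half_line R) (f x)%:E = 1)%E].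

(* A curve is u : R -> R -> R, with u tau the element of L^1(0,oo) at time tau;
   only the times tau >= 0 matter, so that limits at tau = 0 are one-sided. *)
Definition L1_continuous (R : realType) (u : R -> R -> R) : Prop :=
  forall tau : R, 0 <= tau ->
    L1_norm (fun x => u s x - u tau x)
      @[s --> within [set s | 0 <= s] (nbhs tau)] --> (0 : \bar R)%E.

Definition L1_derivative (R : realType) (u du : R -> R -> R) : Prop :=
  forall tau : R, 0 <= tau ->
    L1_norm (fun x => (s - tau)^-1 * (u s x - u tau x) - du tau x)
      @[s --> within [set s | 0 <= s /\ s != tau] (nbhs tau)]
      --> (0 : \bar R)%E.

(* The right-hand side of the evolution equation. *)
Definition evol_rhs (R : realType) (f : R -> R) (x : R) : R :=
  - f x + 2 * \int[@lebesgue_measure R]_(y in half_line R) (f y * f (x + y)).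

Definition evol_solution (R : realType) (p : R -> R -> R) : Prop :=
  (forall tau, 0 <= tau -> prob_density (p tau)) /\
  exists dp : R -> R -> R,
    [/\ forall tau, 0 <= tau -> in_L1 (dp tau),
        L1_derivative p dp,
        L1_continuous dp &
        forall tau, 0 <= tau -> eq_L1 (dp tau) (evol_rhs (p tau))].

Definition exp_poly (R : realType) (lambda : R) (N : nat) (c : 'I_N.+1 -> R)
    (x : R) : R :=
  lambda * (\sum_(n < N.+1) c n * ((lambda * x) ^+ n / (n`!)%:R))
    * expR (- (lambda * x)).

Definition mean (R : realType) (f : R -> R) : R :=
  \int[@lebesgue_measure R]_(x in half_line R) (x * f x).

Definition asymp_equiv (R : realType) (f g : R -> R) : Prop :=
  f s / g s @[s --> +oo] --> (1 : R).

(* Gives a meaning to the value at each x > 0 of an element of L^1(0,oo): a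
   continuous representative is unique on half_line when it exists. *)
Definition continuous_rep (R : realType) (f g : R -> R) : Prop :=
  (forall x, half_line R x -> {for x, continuous g}) /\ eq_L1 f g.

(* Main.v *)
Require Import Defs.
From HB Require Import structures.
From mathcomp Require Import all_boot all_order all_algebra.
From mathcomp Require Import all_classical all_reals all_analysis.
From mathcomp Require Import measurable_realfun ring lra.

Set Implicit Arguments.
Unset Strict Implicit.
Unset Printing Implicit Defensive.

Import Order.TTheory GRing.Theory Num.Theory.
Import numFieldNormedType.Exports.

Local Open Scope classical_set_scope.
Local Open Scope ring_scope.

(** The equation is quadratic, but it becomes linear once the solution p itself
    is frozen in one of the two factors:
      v' = - v + 2 B(p, v),   B(f, g)(x) = int_0^oo f(y) g(x + y) dy.
    For any f the operator B(f, .) maps the space of exponential polynomials of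
    degree at most N into itself ([corr_rev_exp_poly]): on coefficients it is
    sum_j a_j S^j, where S is the shift lowering the degree by one and
    a_j = int f(y) (lambda y)^j / j! exp(- lambda y) dy.  The linear equation is
    therefore a triangular system of ordinary differential equations with
    coefficients a_j(t) continuous in t, and is solved by successive
    integrations ([iterated_primitives]).  Its solution and p solve the same
    linear equation with bounded operators in L^1 and the same initial
    condition, so they coincide by a Gronwall argument ([weak_gronwall]); this
    is [solution_form].

    As the a_j commute with each other, the solution is exp(- t + 2 int a_0)
    times exp(2 sum_(j >= 1) A_j S^j) applied to the initial coefficients,
    where A_j is the integral of a_j.  All a_j lie in [0, 1].  Moreover a_1 is
    bounded below by a constant depending on N only ([overlap_lower_bound]): the
    total mass 1 of a polynomial density is a fixed linear combination of
    integrals that a_1 dominates.  So the powers of A_1, which is of order t,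
    dominate, and with th = 2 A_1 the coefficient of degree N - k is asymptotic
    to th^k / k! times that of degree N ([r_ratio]).  The condition that the
    coefficients sum to 1 then gives p_n ~ N! / (N - n)! th^-n.  In particular
    p_0 tends to 1 and the others to 0, hence a_1 tends to 1/4, and th ~ t / 2
    ([coeff_asymptotics]).  The pointwise limit and the mean follow because both
    are linear in the coefficients. *)

(** * Derivatives of real functions in applied form *)

Section DeriveRules.
Context {R : realType}.
Implicit Types (f g : R -> R) (x a b c : R).

Lemma is_derive_fM f g x a b : is_derive x 1 f a -> is_derive x 1 g b ->
  is_derive x 1 (fun x => f x * g x) (a * g x + f x * b).
Proof.
move=> df dg; have h := is_deriveM df dg.
by apply: (is_derive_eq h); rewrite /GRing.scale/= addrC mulrC.
Qed.

Lemma is_derive_fD f g x a b : is_derive x 1 f a -> is_derive x 1 g b ->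
  is_derive x 1 (fun x => f x + g x) (a + b).
Proof. exact: is_deriveD. Qed.

Lemma is_derive_fB f g x a b : is_derive x 1 f a -> is_derive x 1 g b ->
  is_derive x 1 (fun x => f x - g x) (a - b).
Proof. exact: is_deriveB. Qed.

Lemma is_derive_fZ c f x a : is_derive x 1 f a ->
  is_derive x 1 (fun x => c * f x) (c * a).
Proof. exact: is_deriveZ. Qed.

Lemma is_derive_fZr c f x a : is_derive x 1 f a ->
  is_derive x 1 (fun x => f x * c) (a * c).
Proof.
move=> df; have -> : (fun x => f x * c) = (fun x => c * f x).
  by apply/funext => y; rewrite mulrC.
by rewrite mulrC; exact: is_deriveZ.
Qed.

Lemma is_derive_fX f n x a : is_derive x 1 f a ->
  is_derive x 1 (fun x => f x ^+ n) (n%:R * f x ^+ n.-1 * a).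
Proof.
move=> df; have := is_deriveX n df.
have -> : (f ^+ n : R -> R) = (fun x => f x ^+ n); last by [].
elim: n => [|n ih]; first by rewrite expr0; apply/funext => y; rewrite expr0.
by rewrite exprS ih; apply/funext => y; rewrite exprS.
Qed.

Lemma is_derive_expRf f x a : is_derive x 1 f a ->
  is_derive x 1 (fun x => expR (f x)) (a * expR (f x)).
Proof.
move=> df; have := is_derive1_comp (is_derive_expR (f x)) df.
by rewrite mulrC.
Qed.

Lemma is_derive_fsum n (h : 'I_n -> R -> R) (dh : 'I_n -> R) x :
  (forall i, is_derive x 1 (h i) (dh i)) ->
  is_derive x 1 (fun x => \sum_(i < n) h i x) (\sum_(i < n) dh i).
Proof.
move=> /is_derive_sum; rewrite (_ : \sum_(i < n) h i = fun x => \sum_(i < n) h i x)//.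
by apply/funext => y; rewrite fct_sumE.
Qed.

Lemma is_derive_continuous f x a : is_derive x 1 f a -> {for x, continuous f}.
Proof. by move=> [/derivable1_diffP/differentiable_continuous]. Qed.

End DeriveRules.

(** * Exponentially damped monomials *)

(** For s = 1, [lambda * wexp lambda 1 n] is the Erlang density of shape n + 1
    and rate lambda; these densities span the exponential polynomials.  The
    bare [wexp] is bounded by 1 for s >= 1 and serves as a test function.  The
    parameter s makes the family closed under products up to constants, the
    values of s being added. *)
Definition wexp (R : realType) (lambda s : R) (n : nat) (x : R) : R :=
  (lambda * x) ^+ n / (n`!)%:R * expR (- (s * (lambda * x))).

Section Wexp.
Context {R : realType}.
Implicit Types (lambda s x : R) (n : nat).
Local Notation mu := (@lebesgue_measure R).
Local Notation D := (half_line R).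

Lemma fact_neq0 n : (n`!)%:R != 0 :> R.
Proof. by rewrite pnatr_eq0 -lt0n fact_gt0. Qed.

Lemma wexp_ge0 lambda s n x : 0 < lambda -> 0 <= x -> 0 <= wexp lambda s n x.
Proof.
move=> l0 x0; rewrite mulr_ge0 ?expR_ge0// divr_ge0// exprn_ge0// mulr_ge0//.
exact: ltW.
Qed.

Lemma exprn_fact_le_expR x n : 0 <= x -> x ^+ n / (n`!)%:R <= expR x.
Proof.
case: n => [|n] x0; first by rewrite expr0 divr1 -expR0 ler_expR.
by apply: le_trans (expR_ge1Dxn n x0); rewrite lerDr.
Qed.

Lemma wexp_le1 lambda s n x : 0 < lambda -> 1 <= s -> 0 <= x ->
  wexp lambda s n x <= 1.
Proof.
move=> l0 s1 x0; rewrite /wexp expRN ler_pdivrMr ?expR_gt0// mul1r.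
have lx : 0 <= lambda * x by rewrite mulr_ge0// ltW.
by rewrite (le_trans (exprn_fact_le_expR n lx))// ler_expR ler_peMl.
Qed.

Lemma is_derive_wexp lambda s m x : is_derive x 1 (wexp lambda s m)
   ((if m is m'.+1 then lambda * wexp lambda s m' x else 0)
    - s * lambda * wexp lambda s m x).
Proof.
have dl : is_derive x 1 (fun x => lambda * x) lambda.
  by apply: (is_derive_eq (is_derive_fZ lambda (is_derive_id x 1))); rewrite mulr1.
have de : is_derive x 1 (fun x => expR (- (s * (lambda * x))))
    (- (s * lambda) * expR (- (s * (lambda * x)))).
  by apply: is_derive_expRf; apply: is_deriveN; exact: is_derive_fZ.
have dm : is_derive x 1 (fun x => (lambda * x) ^+ m / m`!%:R)
    (m%:R * (lambda * x) ^+ m.-1 * lambda / m`!%:R).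
  exact/is_derive_fZr/is_derive_fX.
apply: (is_derive_eq (is_derive_fM dm de)).
rewrite /wexp; case: m {dm} => [|m] /=; first by ring.
rewrite factS natrM; field.
by rewrite fact_neq0 lt0r_neq0 // ltr_wpDr.
Qed.

Lemma continuous_wexp lambda s n : continuous (wexp lambda s n).
Proof. by move=> x; apply: is_derive_continuous; exact: is_derive_wexp. Qed.

Lemma measurable_wexp lambda s n (A : set R) : measurable A ->
  measurable_fun A (wexp lambda s n).
Proof.
move=> mA; apply: (measurable_funS measurableT) => //.
apply: (continuous_measurable_fun); exact: continuous_wexp.
Qed.

Lemma cvg_wexp_infty lambda s n : 0 < lambda -> 0 < s ->
  wexp lambda s n x @[x --> +oo] --> (0 : R).
Proof.
move=> l0 s0.
pose C : R := (n.+1)`!%:R / (n`!%:R * s ^+ n.+1 * lambda).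
apply: (@squeeze_cvgr _ _ _ _ (fun=> 0) (fun x => C * x^-1)).
- near=> x.
  have x0 : 0 < x by near: x; exact: nbhs_pinfty_gt.
  rewrite (wexp_ge0 _ _ l0 (ltW x0)) /=.
  have y0 : 0 < s * (lambda * x) by rewrite !mulr_gt0.
  have := exprn_fact_le_expR n.+1 (ltW y0).
  rewrite /wexp expRN => h.
  rewrite ler_pdivrMr ?expR_gt0//.
  apply: le_trans (ler_wpM2l _ h); last first.
    by rewrite mulr_ge0// ?invr_ge0 ?(ltW x0)// divr_ge0// !mulr_ge0 ?exprn_ge0// ltW.
  rewrite le_eqVlt; apply/orP; left; apply/eqP; rewrite /C.
  rewrite !exprMn !exprS; field.
  by rewrite !fact_neq0 !gt_eqF//= exprn_gt0.
- exact: cvg_cst.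
- rewrite -[X in _ --> X](mulr0 C); apply: cvgMr.
  by apply/gtr0_cvgV0; [near=> x; near: x; exact: nbhs_pinfty_gt | exact: cvg_id].
Unshelve. all: by end_near. Qed.

(** Integration by parts lowers n by one, so that an antiderivative vanishing at
    infinity is built by induction; its value at 0 is minus the integral. *)
Lemma wexp_primitive lambda s n : 0 < lambda -> 0 < s ->
  exists F : R -> R, [/\ F x @[x --> +oo] --> (0 : R), F 0 = - s ^- n.+1 &
    forall x, is_derive x 1 F (lambda * wexp lambda s n x)].
Proof.
move=> l0 s0.
pose dw m x := is_derive_wexp lambda s m x.
elim: n => [|n [F [F1 F2 F3]]].
  exists (fun x => - s^-1 * wexp lambda s 0 x); split.
  - by rewrite -[X in _ --> X](mulr0 (- s^-1)); apply: cvgMr; exact: cvg_wexp_infty.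
  - by rewrite /wexp mulr0 mulr0 oppr0 expR0 expr0 fact0 divr1 !mulr1 expr1.
  - move=> x; apply: (is_derive_eq (is_derive_fZ _ (dw 0 x))).
    by rewrite /=; field; exact: lt0r_neq0.
exists (fun x => s^-1 * (F x - wexp lambda s n.+1 x)); split.
- rewrite -[X in _ --> X](mulr0 s^-1); apply: cvgMr.
  rewrite -[X in _ --> X](subr0 0); apply: cvgB => //; exact: cvg_wexp_infty.
- rewrite F2 /wexp mulr0 expr0n !mul0r subr0 mulrN -invfM -exprS //.
- move=> x; apply: (is_derive_eq (is_derive_fZ _ (is_derive_fB (F3 x) (dw n.+1 x)))).
  by field; exact: lt0r_neq0.
Qed.

Lemma measurable_half_line : measurable D.
Proof. exact: measurable_itv. Qed.

Lemma integral_wexp lambda s n : 0 < lambda -> 0 < s ->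
  (\int[mu]_(x in D) (lambda * wexp lambda s n x)%:E = (s ^- n.+1)%:E)%E.
Proof.
move=> l0 s0; have [F [F1 F2 F3]] := wexp_primitive n l0 s0.
rewrite /half_line integral_itv_obnd_cbnd; last first.
  apply/measurable_EFinP; apply: measurable_funM; first exact: measurable_cst.
  exact: measurable_wexp.
rewrite (@ge0_continuous_FTC2y _ _ F 0 0).
- by rewrite F2 -EFinB sub0r opprK.
- by move=> x x0; rewrite mulr_ge0 ?(ltW l0)// wexp_ge0.
- apply: continuous_subspaceT => x; apply: cvgMr; exact: continuous_wexp.
- exact: F1.
- by move=> x _; have [] := F3 x.
- by apply: cvg_at_right_filter; exact: is_derive_continuous (F3 0).
- by move=> x _; rewrite derive1E; have [_ ->] := F3 x.
Qed.

Lemma in_L1_wexp lambda s n : 0 < lambda -> 0 < s ->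
  in_L1 (fun x => lambda * wexp lambda s n x).
Proof.
move=> l0 s0; apply/integrableP; split.
  apply/measurable_EFinP; apply: measurable_funM; first exact: measurable_cst.
  by apply: measurable_wexp; exact: measurable_half_line.
rewrite (_ : (\int[mu]_(x in D) _)%E = (s ^- n.+1)%:E) ?ltry//.
rewrite -(integral_wexp n l0 s0); apply: eq_integral => x.
rewrite inE /half_line /= in_itv/= andbT => x0.
by rewrite ger0_norm// mulr_ge0 ?(ltW l0)// wexp_ge0// ltW.
Qed.

Lemma Rintegral_wexp lambda s n : 0 < lambda -> 0 < s ->
  \int[mu]_(x in D) (lambda * wexp lambda s n x) = s ^- n.+1.
Proof. by move=> l0 s0; rewrite /Rintegral integral_wexp. Qed.

End Wexp.

(** * Pairing of integrable functions with bounded ones *)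

(** Bounded measurable functions on the half-line: the dual of L^1, through
    which L^1-valued curves are reduced to real functions. *)
Definition bounded_test (R : realType) (M : R) (psi : R -> R) : Prop :=
  measurable_fun (half_line R) psi /\ (forall x, half_line R x -> `|psi x| <= M).

Definition pairing (R : realType) (f psi : R -> R) : R :=
  \int[@lebesgue_measure R]_(x in half_line R) (f x * psi x).

Section L1.
Context {R : realType}.
Implicit Types (f g psi : R -> R) (M c : R).
Local Notation mu := (@lebesgue_measure R).
Local Notation D := (half_line R).

Let mD : measurable D := @measurable_half_line R.

Lemma half_lineE (x : R) : half_line R x <-> 0 < x.
Proof. by rewrite /half_line /= in_itv/= andbT. Qed.

Lemma in_L1_measurable f : in_L1 f -> measurable_fun D f.
Proof. by move=> /integrableP[/measurable_EFinP]. Qed.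

Lemma in_L1D f g : in_L1 f -> in_L1 g -> in_L1 (fun x => f x + g x).
Proof. by move=> intf intg; exact: (@integrableD _ _ _ mu D mD (EFin \o f) (EFin \o g)). Qed.

Lemma in_L1B f g : in_L1 f -> in_L1 g -> in_L1 (fun x => f x - g x).
Proof. by move=> intf intg; exact: (@integrableB _ _ _ mu D mD (EFin \o f) (EFin \o g)). Qed.

Lemma in_L1Z c f : in_L1 f -> in_L1 (fun x => c * f x).
Proof. by move=> intf; exact: (@integrableZl _ _ _ mu D mD c (EFin \o f)). Qed.

Lemma in_L1_sum n (h : 'I_n -> R -> R) : (forall i, in_L1 (h i)) ->
  in_L1 (fun x => \sum_(i < n) h i x).
Proof.
move=> hL.
have := @integrable_sum _ _ _ mu D mD _ (index_enum 'I_n) xpredT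
  (fun i => EFin \o h i) (fun i _ => hL i).
rewrite /in_L1; apply: eq_integrable => // x _.
by rewrite /= sumEFin.
Qed.

Lemma in_L1M M f psi : in_L1 f -> bounded_test M psi ->
  in_L1 (fun x => f x * psi x).
Proof.
move=> intf [mpsi psiM].
apply: (@integrableMl _ _ _ mu D mD (EFin \o f) psi) => //.
exists M; split; first exact: num_real.
by move=> y My x Dx; apply: le_trans (psiM x Dx) (ltW My).
Qed.

Lemma L1_norm_ge0 f : (0 <= L1_norm f)%E.
Proof. by apply: integral_ge0 => x _; rewrite lee_fin. Qed.

Lemma L1_norm_fin f : in_L1 f -> L1_norm f \is a fin_num.
Proof.
move=> /integrableP[_ h]; rewrite ge0_fin_numE ?L1_norm_ge0//.
Qed.

Lemma L1_norm_Rintegral f : in_L1 f ->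
  fine (L1_norm f) = \int[mu]_(x in D) `|f x|.
Proof. by []. Qed.

Lemma L1_norm_abs f : in_L1 f -> in_L1 (fun x => `|f x|).
Proof. by move=> /integrable_norm. Qed.

Lemma L1_le_norm_Rintegral f : in_L1 f ->
  `|\int[mu]_(x in D) f x| <= \int[mu]_(x in D) `|f x|.
Proof. exact: (@le_normr_Rintegral _ (measurableTypeR R)). Qed.

Lemma L1_RintegralZ c f : in_L1 f ->
  \int[mu]_(x in D) (c * f x) = c * \int[mu]_(x in D) f x.
Proof. exact: (@RintegralZl _ (measurableTypeR R)). Qed.

Lemma L1_RintegralD f g : in_L1 f -> in_L1 g ->
  \int[mu]_(x in D) (f x + g x) = \int[mu]_(x in D) f x + \int[mu]_(x in D) g x.
Proof. exact: (@RintegralD _ (measurableTypeR R)). Qed.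

Lemma L1_RintegralB f g : in_L1 f -> in_L1 g ->
  \int[mu]_(x in D) (f x - g x) = \int[mu]_(x in D) f x - \int[mu]_(x in D) g x.
Proof. exact: (@RintegralB _ (measurableTypeR R)). Qed.

Lemma L1_le_Rintegral f g : in_L1 f -> in_L1 g -> (forall x, D x -> f x <= g x) ->
  \int[mu]_(x in D) f x <= \int[mu]_(x in D) g x.
Proof. exact: (@le_Rintegral _ (measurableTypeR R)). Qed.

Lemma pairing_le M f psi : in_L1 f -> bounded_test M psi ->
  `|pairing f psi| <= M * fine (L1_norm f).
Proof.
move=> intf tpsi; have intfp := in_L1M intf tpsi.
apply: (le_trans (L1_le_norm_Rintegral intfp)).
rewrite L1_norm_Rintegral// -L1_RintegralZ; last exact: L1_norm_abs.
apply: L1_le_Rintegral.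
- exact: L1_norm_abs.
- by apply: in_L1Z; exact: L1_norm_abs.
- move=> x Dx; rewrite normrM mulrC; apply: ler_wpM2r => //.
  by case: tpsi => _; exact.
Qed.

Lemma pairingB M f g psi : in_L1 f -> in_L1 g -> bounded_test M psi ->
  pairing (fun x => f x - g x) psi = pairing f psi - pairing g psi.
Proof.
move=> intf intg tpsi; rewrite /pairing -L1_RintegralB.
- by apply: eq_Rintegral => x _; rewrite mulrBl.
- exact: in_L1M tpsi.
- exact: in_L1M tpsi.
Qed.

Lemma pairingZ M c f psi : in_L1 f -> bounded_test M psi ->
  pairing (fun x => c * f x) psi = c * pairing f psi.
Proof.
move=> intf tpsi; rewrite /pairing -L1_RintegralZ.
- by apply: eq_Rintegral => x _; rewrite mulrA.
- exact: in_L1M tpsi.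
Qed.

Lemma Rintegral_sum n (h : 'I_n -> R -> R) : (forall i, in_L1 (h i)) ->
  \int[mu]_(x in D) (\sum_(i < n) h i x) = \sum_(i < n) \int[mu]_(x in D) h i x.
Proof.
elim: n h => [|n ih] h hL.
  rewrite big_ord0 /Rintegral; under eq_integral do rewrite big_ord0.
  by rewrite integral0.
rewrite big_ord_recl -ih; last by move=> i; exact: hL.
rewrite -L1_RintegralD; [|exact: hL|by apply: in_L1_sum => i; exact: hL].
by apply: eq_Rintegral => x _; rewrite big_ord_recl.
Qed.

Lemma eq_L1_Rintegral f g : measurable_fun D f -> measurable_fun D g ->
  eq_L1 f g -> \int[mu]_(x in D) f x = \int[mu]_(x in D) g x.
Proof.
move=> mf mg fg; congr fine; apply: ae_eq_integral => //.
- exact/measurable_EFinP.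
- exact/measurable_EFinP.
- move: fg; apply: filterS; first exact: (ae_filter_ringOfSetsType mu).
  by move=> x fg Dx /=; rewrite fg.
Qed.

Lemma eq_L1M f g psi : eq_L1 f g -> eq_L1 (fun x => f x * psi x) (fun x => g x * psi x).
Proof.
apply: filterS; first exact: (ae_filter_ringOfSetsType mu).
by move=> x fg Dx; rewrite fg.
Qed.

Lemma L1_norm_eq0 f : in_L1 f -> fine (L1_norm f) = 0 -> eq_L1 f (cst 0).
Proof.
move=> intf f0; have /(ae_eq_integral_abs mu mD) : measurable_fun D (EFin \o f).
  by apply/measurable_EFinP; exact: in_L1_measurable.
move=> [h _]; have : ae_eq mu D (EFin \o f) (cst 0%E).
  by apply: h; rewrite -[RHS]/(0%:E) -f0 fineK ?L1_norm_fin.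
move=> [N [mN N0 sN]]; exists N; split=> // x nx; apply: sN => h1; apply: nx => Dx.
by have [] := h1 Dx.
Qed.

(** Pairing with a bounded function is a continuous linear functional, so it
    commutes with the limit of difference quotients. *)
Lemma pairing_derive M psi (u du : R -> R -> R) (tau : R) :
  bounded_test M psi ->
  (forall s, 0 <= s -> in_L1 (u s)) -> (forall s, 0 <= s -> in_L1 (du s)) ->
  L1_derivative u du -> 0 <= tau ->
  (s - tau)^-1 * (pairing (u s) psi - pairing (u tau) psi)
    @[s --> within [set s | 0 <= s /\ s != tau] (nbhs tau)] -->
    pairing (du tau) psi.
Proof.
move=> tpsi uL duL dudu tau0.
have /fine_cvgP[_ /= h] := dudu _ tau0.
set F := within _ _.
have Mh : M * fine (L1_norm (fun x => (s - tau)^-1 * (u s x - u tau x) - du tau x))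
    @[s --> F] --> (0 : R).
  by rewrite -[X in _ --> X](mulr0 M); exact: cvgMr.
apply/cvgrPdist_lt => e e0.
move/cvgrPdist_lt : Mh => /(_ _ e0) Mh; near=> s.
have [s0 st] : 0 <= s /\ s != tau by near: s; exact: withinT.
have Mhs : `|0 - M * fine (L1_norm (fun x =>
    (s - tau)^-1 * (u s x - u tau x) - du tau x))| < e by near: s; exact: Mh.
rewrite distrC.
rewrite -(pairingB (uL _ s0) (uL _ tau0) tpsi).
rewrite -(pairingZ _ (in_L1B (uL _ s0) (uL _ tau0)) tpsi).
have L1 := in_L1Z (s - tau)^-1 (in_L1B (uL _ s0) (uL _ tau0)).
rewrite -(pairingB L1 (duL _ tau0) tpsi).
apply: le_lt_trans (pairing_le (in_L1B L1 (duL _ tau0)) tpsi) _.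
by apply: le_lt_trans Mhs; rewrite sub0r normrN ler_norm.
Unshelve. all: by end_near. Qed.

End L1.

(** * The bilinear term of the equation *)

(** The bilinear term of the evolution equation. *)
Definition corr (R : realType) (f g : R -> R) (x : R) : R :=
  \int[@lebesgue_measure R]_(y in half_line R) (f y * g (x + y)).

(** Extended-real valued, since it may be infinite on a null set of x. *)
Definition abs_corr (R : realType) (f g : R -> R) (x : R) : \bar R :=
  (\int[@lebesgue_measure R]_(y in half_line R) (`|f y| * `|g (x + y)|)%:E)%E.

Section Corr.
Context {R : realType}.
Implicit Types (f g q : R -> R) (x y M : R).
Local Notation mu := (@lebesgue_measure R).
Local Notation D := (half_line R).

Let mD : measurable D := @measurable_half_line R.

Lemma measurable_addr y (A : set R) : measurable A -> 
  measurable_fun A (fun x : measurableTypeR R => (x + y : measurableTypeR R)).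
Proof. by move=> mA; apply: measurable_funD => //; exact: measurable_cst. Qed.

Lemma lebesgue_measure_shift y (A : set R) : measurable A ->
  pushforward mu (fun x : measurableTypeR R => (x + y : measurableTypeR R)) A = mu A.
Proof.
move=> mA; apply/esym/lebesgue_measure_unique => //; first exact: measurable_addr.
move=> mf _ [[a b]] _ <- /=.
rewrite /pushforward.
rewrite [X in _ = mu X](_ : _ = `]a - y, b - y]%classic).
  rewrite !lebesgue_measure_itv/= !lte_fin ltrD2r.
  by rewrite -!EFinB opprB addrA subrK.
by apply/seteqP; split => x /=; rewrite !in_itv/= ltrBlDr lerBrDr.
Qed.

Lemma ge0_integral_shift y (h : R -> \bar R) : measurable_fun setT h ->
  (forall x, 0 <= h x)%E -> (\int[mu]_x h (x + y)%R = \int[mu]_x h x)%E.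
Proof.
move=> mh h0.
rewrite -(@ge0_integral_pushforward _ _ _ _ R
  (fun x : measurableTypeR R => (x + y : measurableTypeR R)) _ mu setT h)//.
- apply: eq_measure_integral; first exact: measurable_addr.
  by move=> mf A mA _; exact: lebesgue_measure_shift.
- exact: measurable_addr.
Qed.

Let restr f := fun x : measurableTypeR R => `|(f \_ D) x|%:E.

Let mrestr f : measurable_fun D f -> measurable_fun setT (restr f).
Proof.
move=> mf; apply/measurable_EFinP; apply: measurableT_comp => //.
exact/(measurable_restrictT _ mD).
Qed.

Let restrE f x : D x -> restr f x = `|f x|%:E.
Proof. by move=> Dx; rewrite /restr patchE mem_set. Qed.

Let restrN f x : ~ D x -> restr f x = 0%E.
Proof. by move=> Dx; rewrite /restr patchE memNset// normr0. Qed.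

Let kern f g (z : measurableTypeR R * measurableTypeR R) : \bar R :=
  (restr f z.2 * restr g (z.1 + z.2)%R)%E.

Let mkern f g : measurable_fun D f -> measurable_fun D g ->
  measurable_fun setT (kern f g).
Proof.
move=> mf mg; apply: emeasurable_funM.
  by apply: measurableT_comp; [exact: mrestr|exact: measurable_snd].
apply: (measurableT_comp (mrestr mg)).
exact: measurable_funD measurable_fst measurable_snd.
Qed.

Let kern_ge0 f g z : (0 <= kern f g z)%E.
Proof. by rewrite mule_ge0// lee_fin. Qed.

Lemma half_lineD x y : D x -> D y -> D (x + y).
Proof. by rewrite !half_lineE; exact: addr_gt0. Qed.

Let abs_corrE f g x : D x -> abs_corr f g x = (\int[mu]_y kern f g (x, y))%E.
Proof.
move=> Dx; rewrite /abs_corr integral_mkcond; apply: eq_integral => y _.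
rewrite patchE /kern; case: ifPn => [|] yD.
  have Dy : D y by rewrite inE in yD.
  by rewrite !restrE//=; exact: half_lineD.
by rewrite /= restrN ?mul0e// => Dy; rewrite mem_set in yD.
Qed.

Let mkernF f g : measurable_fun D f -> measurable_fun D g ->
  measurable_fun setT (fun x : measurableTypeR R => \int[mu]_y kern f g (x, y))%E.
Proof.
move=> mf mg; exact: (@measurable_fun_fubini_tonelli_F _ _ (measurableTypeR R)
  (measurableTypeR R) R mu _ (mkern mf mg) (kern_ge0 f g)).
Qed.

Lemma measurable_abs_corr f g : measurable_fun D f -> measurable_fun D g ->
  measurable_fun D (abs_corr f g).
Proof.
move=> mf mg.
apply: (@eq_measurable_fun _ _ _ _ D (fun x => \int[mu]_y kern f g (x, y))%E).
  by move=> x; rewrite inE => Dx; rewrite abs_corrE.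
apply: (measurable_funS measurableT) => //.
exact: mkernF.
Qed.

Lemma integral_restr f : (\int[mu]_x restr f x)%E = L1_norm f.
Proof.
rewrite /L1_norm [RHS]integral_mkcond; apply: eq_integral => x _.
by rewrite /restr !patchE; case: ifP => //; rewrite normr0.
Qed.

Let kern_inner f g y : measurable_fun D g ->
  (\int[mu]_x kern f g (x, y) = restr f y * L1_norm g)%E.
Proof.
move=> mg; rewrite -(integral_restr g) -(ge0_integral_shift y (mrestr mg)); last first.
  by move=> x; rewrite lee_fin.
rewrite -ge0_integralZl//.
- by apply: (measurableT_comp (mrestr mg)); exact: measurable_addr.
- by move=> x _; rewrite lee_fin.
- by rewrite lee_fin.
Qed.

(** Tonelli and translation invariance: extended by 0, the integrand is
    |f y| |g (x + y)|, whose integral over x does not depend on y. *)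
Lemma abs_corr_norm f g : in_L1 f -> in_L1 g ->
  (\int[mu]_(x in D) abs_corr f g x <= L1_norm f * L1_norm g)%E.
Proof.
move=> fL gL; have [mf mg] := (in_L1_measurable fL, in_L1_measurable gL).
rewrite (eq_integral (fun x : measurableTypeR R => (\int[mu]_y kern f g (x, y)))%E); last first.
  by move=> x; rewrite inE => Dx; rewrite abs_corrE.
apply: (@le_trans _ _ (\int[mu]_x \int[mu]_y kern f g (x, y))%E).
  apply: ge0_subset_integral => //.
  - exact: mkernF.
  - by move=> x _; apply: integral_ge0 => y _; exact: kern_ge0.
rewrite (@fubini_tonelli _ _ _ _ _ mu mu _ (mkern mf mg) (kern_ge0 f g)).
rewrite (eq_integral (fun y : measurableTypeR R => restr f y * L1_norm g)%E); last first.
  by move=> y _; exact: kern_inner.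
rewrite ge0_integralZr//.
- by rewrite integral_restr.
- exact: mrestr.
- by move=> x _; rewrite lee_fin.
- exact: L1_norm_ge0.
Qed.

Lemma measurable_shift f x : measurable_fun D f -> D x ->
  measurable_fun D (fun y => f (x + y)).
Proof.
move=> mf Dx; apply: (@measurable_comp _ _ _ _ _ _ D f) => //.
  by move=> _ [y Dy <-]; exact: half_lineD.
by apply: measurable_funD => //; exact: measurable_cst.
Qed.

(** The bound holds at every x, including those where f y g (x + y) is not
    integrable in y: there the right-hand side is infinite, because q is
    bounded. *)
Lemma corr_dist M f g q x : in_L1 f -> measurable_fun D g -> bounded_test M q ->
  D x -> (`|corr f g x - corr f q x|%:E <= abs_corr f (fun y => (g y - q y)%R) x)%E.
Proof.
move=> fL mg tq Dx; have mf := in_L1_measurable fL.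
have mgx := measurable_shift mg Dx; have mqx := measurable_shift tq.1 Dx.
have tqx : bounded_test M (fun y => q (x + y)).
  by split=> // y Dy; apply: tq.2; exact: half_lineD.
have [|fin] := boolP (abs_corr f (fun y => (g y - q y)%R) x == +oo)%E.
  by move=> /eqP ->; rewrite leey.
have dL : in_L1 (fun y => f y * (g (x + y) - q (x + y))).
  apply/integrableP; split.
    apply/measurable_EFinP; apply: measurable_funM => //.
    exact: measurable_funB.
  rewrite ltey; apply: contra fin => /eqP <-; apply/eqP; apply: eq_integral => y _.
  by rewrite /= normrM EFinM.
have qL := in_L1M fL tqx.
have -> : corr f g x = corr f q x + \int[mu]_(y in D) (f y * (g (x + y) - q (x + y))).
  rewrite /corr -L1_RintegralD//; apply: eq_Rintegral => y _.
  by ring.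
rewrite addrAC subrr add0r.
rewrite (@EFin_normr_Rintegral _ (measurableTypeR R) R mu)//.
apply: (@le_trans _ _ (\int[mu]_(y in D) `|(f y * (g (x + y) - q (x + y)))%:E|)%E).
  apply: le_abse_integral => //.
  by apply/measurable_EFinP; exact: (in_L1_measurable dL).
rewrite le_eqVlt; apply/orP; left; apply/eqP.
by apply: eq_integral => y _; rewrite /= normrM.
Qed.

End Corr.

(** * Real functions on the half-line *)

Section RealLine.
Context {R : realType}.
Implicit Types (f g F : R -> R) (x s t a : R).

(** A curve on [0, +oo[ is extended to the line by its value at 0, so that
    one-sided continuity at 0 becomes ordinary continuity. *)
Definition ext0 f : R -> R := fun s => f (Num.max 0 s).

Lemma ext0E f s : 0 <= s -> ext0 f s = f s.
Proof. by move=> s0; rewrite /ext0 max_r. Qed.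

Lemma continuous_ext0 f :
  (forall t, 0 <= t -> f s @[s --> within [set s | 0 <= s] (nbhs t)] --> f t) ->
  continuous (ext0 f).
Proof.
move=> cf t; pose m := Num.max 0 t.
have m0 : 0 <= m by rewrite le_max lexx.
apply/cvgrPdist_lt => e e0.
have /cvgrPdist_lt /(_ e e0) := cf m m0.
rewrite near_withinE /= => /nbhs_ballP [d /= d0 h].
apply/nbhs_ballP; exists d => //= s ts; apply: h; last by rewrite le_max lexx.
apply: le_lt_trans ts; rewrite /m.
have [t0|t0] := leP 0 t; have [s0|s0] := leP 0 s => //.
- by rewrite subr0 !ger0_norm//; lra.
- by rewrite sub0r normrN ger0_norm// ler0_norm; lra.
- by rewrite subrr normr0.
Qed.

Lemma is_derive_ext0 f t a : 0 < t -> is_derive t 1 f a -> is_derive t 1 (ext0 f) a.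
Proof.
move=> t0; apply: near_eq_is_derive; near=> s.
by rewrite ext0E// ltW//; near: s; exact: lt_nbhsr.
Unshelve. all: by end_near. Qed.

Lemma is_derive_slope f t a : 0 < t ->
  (s - t)^-1 * (f s - f t) @[s --> within [set s | 0 <= s /\ s != t] (nbhs t)] --> a ->
  is_derive t 1 f a.
Proof.
move=> t0 h.
suff H : h^-1 *: ((f \o shift t) (h *: 1) - f t) @[h --> 0^'] --> a.
  by apply: DeriveDef; [apply/cvg_ex; exists a|apply/cvg_lim].
apply/cvgrPdist_lt => e e0; move/cvgrPdist_lt : h => /(_ e e0).
rewrite near_withinE => /nbhs_ballP [d /= d0 h].
rewrite near_withinE; apply/nbhs_ballP; exists (Num.min d t); first by rewrite /= lt_min d0.
move=> y /=; rewrite /ball/= sub0r normrN lt_min => /andP[yd yt] y0.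
have := h (y + t); rewrite /ball/= addrK; rewrite /GRing.scale/= mulr1; apply.
  by rewrite opprD addrCA subrr addr0 normrN.
split; last by rewrite -subr_eq0 addrK.
by move: yt; rewrite ltr_norml => /andP[]; lra.
Qed.

Lemma continuous_slope f t a :
  (s - t)^-1 * (f s - f t) @[s --> within [set s | 0 <= s /\ s != t] (nbhs t)] --> a ->
  f s @[s --> within [set s | 0 <= s] (nbhs t)] --> f t.
Proof.
move=> h; apply/cvgrPdist_lt => e e0; rewrite near_withinE.
have /cvgrPdist_lt /(_ 1 ltr01) := h.
rewrite near_withinE => /nbhs_ballP [d /= d0 h1].
have k0 : 0 < `|a| + 1 by rewrite ltr_wpDl.
apply/nbhs_ballP; exists (Num.min d (e / (`|a| + 1))).
  by rewrite /= lt_min d0 divr_gt0.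
move=> s /=; rewrite /ball/= lt_min => /andP[sd se] s0.
have [->|st] := eqVneq s t; first by rewrite subrr normr0.
have := h1 s sd (conj s0 st).
have -> : f t - f s = - ((s - t) * ((s - t)^-1 * (f s - f t))).
  by rewrite mulVKf ?subr_eq0// opprB.
set q := _^-1 * _ => aq; rewrite normrN normrM.
have : `|q| < `|a| + 1.
  by rewrite -(subrK a q) (le_lt_trans (ler_normD _ _))// addrC ltrD2l distrC.
move: se; rewrite distrC ltr_pdivlMr// => se qa.
apply: le_lt_trans se; apply: ler_wpM2l => //; exact: ltW.
Qed.

(** The integral is started at -1 rather than 0, so that the primitive is
    differentiable, hence continuous, at 0 as well. *)
Lemma primitive_exists f : continuous f ->
  exists F, [/\ F 0 = 0, continuous F & forall t, 0 < t -> is_derive t 1 F (f t)].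
Proof.
move=> cf.
pose G t := \int[@lebesgue_measure R]_(x in `[(-1), t]) f x.
have dG t : -1 < t -> is_derive t 1 G (f t).
  move=> t1; have [//| |//| |dG Gf] := @continuous_FTC1_closed R f (-1) t (t + 1).
  - by rewrite ltrDl.
  - by apply: continuous_compact_integrable; [exact: segment_compact|exact: continuous_subspaceT].
  - exact: cf.
  - apply: DeriveDef; [exact: dG|by rewrite -derive1E].
exists (ext0 (fun t => G t - G 0)); split.
- by rewrite ext0E// subrr.
- apply: continuous_ext0 => t t0; apply: cvgB; last exact: cvg_cst.
  apply: cvg_within_filter.
  by apply: (is_derive_continuous (a := f t)); apply: dG; apply: lt_le_trans t0; rewrite oppr_lt0.
- move=> t t0; apply: is_derive_ext0 => //; rewrite -[f t]subr0.
  by apply: is_derive_fB; apply: dG; apply: lt_trans t0; rewrite oppr_lt0.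
Qed.

(** Comparison of two functions through their derivatives, in the form in which
    differential inequalities are integrated below. *)
Lemma le_of_derive_le f g df dg (a b : R) : a <= b ->
  continuous f -> continuous g ->
  (forall t, a < t < b -> is_derive t 1 f (df t)) ->
  (forall t, a < t < b -> is_derive t 1 g (dg t)) ->
  (forall t, a < t < b -> df t <= dg t) -> f a <= g a -> f b <= g b.
Proof.
rewrite le_eqVlt => /predU1P[<- //|ab] cf cg hf hg le fa.
have [||c] := @MVT R (g \- f) (fun t => dg t - df t) a b ab.
- by move=> c; rewrite in_itv/= => h; apply: is_derive_fB; [exact: hg|exact: hf].
- by apply: continuous_subspaceT => z; apply: cvgB; [exact: cg|exact: cf].
rewrite in_itv/= => cab /= E.
have : 0 <= (dg c - df c) * (b - a).
  by rewrite mulr_ge0 ?subr_ge0 ?(ltW ab)//; exact: le.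
by rewrite -E; lra.
Qed.

End RealLine.

(** * Uniqueness for linear equations in L^1 *)

(** The derivative in L^1 tested against bounded functions: this is all that the
    uniqueness argument needs, and it is immediate for a finite combination of
    fixed functions with differentiable coefficients. *)
Definition weak_derivative (R : realType) (u du : R -> R -> R) : Prop :=
  forall M psi, bounded_test M psi ->
    continuous (ext0 (fun s => pairing (u s) psi)) /\
    forall t : R, 0 < t ->
      is_derive t 1 (ext0 (fun s => pairing (u s) psi)) (pairing (du t) psi).

Section Weak.
Context {R : realType}.
Implicit Types (u du v dv : R -> R -> R) (f psi : R -> R) (s t T : R).
Local Notation mu := (@lebesgue_measure R).
Local Notation D := (half_line R).
Let mD : measurable D := @measurable_half_line R.

Lemma sign_test f : in_L1 f -> exists psi, bounded_test 1 psi /\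
  pairing f psi = fine (L1_norm f).
Proof.
move=> fL; have mf := in_L1_measurable fL.
pose A := D `&` f @^-1` `[0, +oo[.
have mA : measurable A by apply: mf => //; exact: measurable_itv.
(* the sign of f, with the value 1 where f vanishes *)
exists (fun x => 2 * \1_A x - 1); split; first split.
- apply: measurable_funB; last exact: measurable_cst.
  by apply: measurable_funM; [exact: measurable_cst|exact: measurable_indic].
- move=> x _; rewrite indicE; case: (x \in A) => /=.
  + by rewrite mulr1 ger0_norm; lra.
  + by rewrite mulr0 sub0r normrN1.
- rewrite L1_norm_Rintegral//; apply: eq_Rintegral => x; rewrite inE => Dx.
  rewrite indicE; have [fx|fx] := leP 0 (f x).
  + rewrite mem_set/=; first by rewrite ger0_norm// mulr1; lra.
    by split=> //=; rewrite in_itv/= fx.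
  + rewrite memNset/=; first by rewrite ler0_norm ?(ltW fx)//; lra.
    by move=> [_ /=]; rewrite in_itv/= andbT leNgt fx.
Qed.

Lemma weak_derivative_L1 u du :
  (forall s : R, 0 <= s -> in_L1 (u s)) -> (forall s : R, 0 <= s -> in_L1 (du s)) ->
  L1_derivative u du -> weak_derivative u du.
Proof.
move=> uL duL udu M psi tpsi; have slope (t : R) (t0 : 0 <= t) := pairing_derive tpsi uL duL udu t0.
split.
- by apply: continuous_ext0 => t t0; exact: (continuous_slope (slope t t0)).
- by move=> t t0; apply: is_derive_ext0 => //; exact: is_derive_slope t0 (slope t (ltW t0)).
Qed.

Lemma weak_derivativeB u du v dv :
  (forall s : R, 0 <= s -> in_L1 (u s)) -> (forall s : R, 0 <= s -> in_L1 (du s)) ->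
  (forall s : R, 0 <= s -> in_L1 (v s)) -> (forall s : R, 0 <= s -> in_L1 (dv s)) ->
  weak_derivative u du -> weak_derivative v dv ->
  weak_derivative (fun s x => u s x - v s x) (fun s x => du s x - dv s x).
Proof.
move=> uL duL vL dvL wu wv M psi tpsi.
have [cu du'] := wu M psi tpsi; have [cv dv'] := wv M psi tpsi.
have -> : ext0 (fun s => pairing (fun x => u s x - v s x) psi) =
    fun s => ext0 (fun s => pairing (u s) psi) s - ext0 (fun s => pairing (v s) psi) s.
  apply/funext => s; rewrite /ext0 (pairingB _ _ tpsi)//.
  - by apply: uL; rewrite le_max lexx.
  - by apply: vL; rewrite le_max lexx.
split; first by move=> s; apply: cvgB; [exact: cu|exact: cv].
move=> t t0; rewrite (pairingB (duL _ (ltW t0)) (dvL _ (ltW t0)) tpsi).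
by apply: is_derive_fB; [exact: du'|exact: dv'].
Qed.

(** At each time s the L^1 norm of u s is the pairing of u s with its sign, and
    the derivative of the pairing with that fixed sign is at most K times the
    norm.  Hence a bound b exp(2Ks) for the norm on [0, T] improves to
    (b/2) exp(2Ks), and by iteration the norm vanishes. *)
Lemma weak_gronwall (K : R) u du : 0 < K ->
  (forall s : R, 0 <= s -> in_L1 (u s)) -> (forall s : R, 0 <= s -> in_L1 (du s)) ->
  weak_derivative u du ->
  (forall s : R, 0 <= s -> fine (L1_norm (du s)) <= K * fine (L1_norm (u s))) ->
  (forall T, exists B : R, forall s : R, 0 <= s <= T -> fine (L1_norm (u s)) <= B) ->
  eq_L1 (u 0) (cst 0) ->
  forall s, 0 <= s -> eq_L1 (u s) (cst 0).
Proof.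
move=> K0 uL duL wu duK bu u0 T T0.
have [B0 hB0] := bu T; pose B := Num.max 0 B0.
have B_ge0 : 0 <= B by rewrite le_max lexx.
have hB s : 0 <= s <= T -> fine (L1_norm (u s)) <= B.
  by move=> sT; rewrite le_max hB0// orbT.
have step b : 0 <= b ->
    (forall s : R, 0 <= s <= T -> fine (L1_norm (u s)) <= b * expR (2 * K * s)) ->
    forall s, 0 <= s <= T -> fine (L1_norm (u s)) <= b / 2 * expR (2 * K * s).
  move=> b0 hb s /andP[s0 sT]; have [psi [tpsi Epsi]] := sign_test (uL s s0).
  have [cf df] := wu _ _ tpsi.
  set f := ext0 _ in cf df.
  have fs : f s = fine (L1_norm (u s)) by rewrite /f ext0E.
  have f0 : f 0 = 0.
    rewrite /f ext0E// /pairing (@eq_L1_Rintegral _ _ (fun x => 0 * psi x)).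
    - by under eq_Rintegral do rewrite mul0r; rewrite /Rintegral integral0.
    - exact: in_L1_measurable (in_L1M (uL 0 (lexx 0)) tpsi).
    - by apply: measurable_funM; [exact: measurable_cst|exact: tpsi.1].
    - exact: eq_L1M u0.
  rewrite -fs.
  have dg (t : R) : is_derive t 1 (fun t => b / 2 * expR (2 * K * t)) (b * K * expR (2 * K * t)).
    have h : is_derive t 1 (fun t => 2 * K * t) (2 * K).
      by apply: (is_derive_eq (is_derive_fZ (2 * K) (is_derive_id t 1))); rewrite mulr1.
    by apply: (is_derive_eq (is_derive_fZ (b / 2) (is_derive_expRf h))); lra.
  have df' t : 0 < t < s -> is_derive t 1 f (pairing (du t) psi).
    by move=> /andP[t0 _]; exact: df.
  apply: (le_of_derive_le s0 cf _ df' (fun t _ => dg t)).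
  - by move=> t; apply: is_derive_continuous (dg t).
  - move=> t /andP[t0 ts].
    apply: le_trans (ler_norm _) _; apply: le_trans (pairing_le (duL t (ltW t0)) tpsi) _.
    rewrite mul1r; apply: le_trans (duK _ (ltW t0)) _.
    rewrite [b * K]mulrC -(mulrA K b); apply: ler_wpM2l; [exact: ltW|apply: hb].
    by rewrite (ltW t0) (le_trans (ltW ts) sT).
  - by rewrite f0 mulr_ge0 ?divr_ge0 ?expR_ge0.
have all_m m s : 0 <= s <= T -> fine (L1_norm (u s)) <= B / 2 ^+ m * expR (2 * K * s).
  elim: m s => [|m ih] s sT.
    rewrite expr0 divr1; apply: le_trans (hB s sT) _.
    rewrite ler_peMr// -expR0 ler_expR !mulr_ge0//; last by case/andP: sT.
    exact: ltW.
  rewrite exprSr invfM mulrA; apply: step => //.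
  by rewrite divr_ge0 ?exprn_ge0.
apply: L1_norm_eq0; first exact: uL.
have lim0 : B / 2 ^+ m * expR (2 * K * T) @[m --> \oo] --> (0 : R).
  rewrite -[X in _ --> X](mul0r (expR (2 * K * T))); apply: cvgMl.
  rewrite -[X in _ --> X](mulr0 B); apply: cvgMr.
  under eq_cvg do rewrite -exprVn; apply: cvg_expr; rewrite ger0_norm//; lra.
apply/eqP; rewrite eq_le; apply/andP; split.
  apply: (ler_cvg_to (cvg_cst (fine (L1_norm (u T)))) lim0); apply: nearW => m.
  by apply: all_m; rewrite T0 lexx.
by rewrite fine_ge0// L1_norm_ge0.
Qed.

End Weak.

(** * Invariance of the exponential polynomials *)

(** Coefficients are numbered from the top degree down, b k being that of degree
    N - k: [corr] with p(., t) then acts on them by a lower triangular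
    Toeplitz matrix, and the index k runs over all of nat. *)
Definition rev_exp_poly (R : realType) (lambda : R) (N : nat) (b : nat -> R) : R -> R :=
  exp_poly lambda (fun n : 'I_N.+1 => b (N - n)%N).

Definition conv (R : realType) (a b : nat -> R) (k : nat) : R :=
  \sum_(j < k.+1) a j * b (k - j)%N.

Section ExpPoly.
Context {R : realType}.
Implicit Types (lambda x y M : R) (f psi : R -> R) (N n k : nat).
Local Notation mu := (@lebesgue_measure R).
Local Notation D := (half_line R).

Lemma exp_polyE lambda N (c : 'I_N.+1 -> R) x :
  exp_poly lambda c x = \sum_(n < N.+1) c n * (lambda * wexp lambda 1 n x).
Proof.
rewrite /exp_poly mulr_sumr mulr_suml; apply: eq_bigr => n _.
by rewrite /wexp mul1r; ring.
Qed.

Lemma in_L1_exp_poly lambda N (c : 'I_N.+1 -> R) : 0 < lambda ->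
  in_L1 (exp_poly lambda c).
Proof.
move=> l0; rewrite (_ : exp_poly lambda c =
    fun x => \sum_(n < N.+1) c n * (lambda * wexp lambda 1 n x)).
  by apply: in_L1_sum => n; apply: in_L1Z; exact: in_L1_wexp.
by apply/funext => x; rewrite exp_polyE.
Qed.

Lemma wexp_test lambda s n : 0 < lambda -> 1 <= s -> bounded_test 1 (wexp lambda s n).
Proof.
move=> l0 s1; split; first by apply: measurable_wexp; exact: measurable_half_line.
move=> x; rewrite half_lineE => x0.
by rewrite ger0_norm ?wexp_ge0// ?wexp_le1// ltW.
Qed.

Lemma exp_poly_test lambda N (c : 'I_N.+1 -> R) : 0 < lambda ->
  bounded_test (\sum_(n < N.+1) `|c n| * lambda) (exp_poly lambda c).
Proof.
move=> l0; split; first exact: in_L1_measurable (in_L1_exp_poly c l0).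
move=> x Dx; rewrite exp_polyE; apply: le_trans (ler_norm_sum _ _ _) _.
apply: ler_sum => n _; rewrite normrM (normrM lambda) (gtr0_norm l0).
apply: ler_wpM2l => //; rewrite ler_piMr ?(ltW l0)//.
by apply: (wexp_test n l0 (lexx (1 : R))).2.
Qed.

Lemma pairing_exp_poly M lambda N (c : 'I_N.+1 -> R) psi : 0 < lambda ->
  bounded_test M psi ->
  pairing (exp_poly lambda c) psi =
  \sum_(n < N.+1) c n * pairing (fun x => lambda * wexp lambda 1 n x) psi.
Proof.
move=> l0 tpsi.
have wL n := in_L1M (in_L1_wexp n l0 ltr01) tpsi.
under eq_bigr do rewrite /pairing -(L1_RintegralZ _ (wL _)).
rewrite -Rintegral_sum; last by move=> n; exact: in_L1Z.
apply: eq_Rintegral => x _; rewrite exp_polyE mulr_suml.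
by apply: eq_bigr => n _; rewrite !mulrA.
Qed.

Lemma Rintegral_exp_poly lambda N (c : 'I_N.+1 -> R) : 0 < lambda ->
  \int[mu]_(x in D) exp_poly lambda c x = \sum_(n < N.+1) c n.
Proof.
move=> l0; under eq_Rintegral do rewrite exp_polyE.
rewrite Rintegral_sum; last by move=> n; apply: in_L1Z; exact: in_L1_wexp.
apply: eq_bigr => n _; rewrite L1_RintegralZ; last exact: in_L1_wexp.
by rewrite Rintegral_wexp// expr1n invr1 mulr1.
Qed.

Lemma wexpM lambda s s' m n x :
  wexp lambda s m x * wexp lambda s' n x =
  'C(m + n, n)%:R * wexp lambda (s + s') (m + n) x.
Proof.
have h : (m + n)`!%:R = 'C(m + n, n)%:R * n`!%:R * m`!%:R :> R.
  by rewrite -!natrM -(bin_fact (leq_addl m n)) addnK mulnA.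
rewrite /wexp mulrDl opprD expRD exprD h; field.
by rewrite !fact_neq0 pnatr_eq0 -lt0n bin_gt0 leq_addl.
Qed.

Lemma pairing_wexp lambda s m n : 0 < lambda -> 1 <= s ->
  pairing (fun x => lambda * wexp lambda 1 m x) (wexp lambda s n) =
  'C(m + n, n)%:R * (1 + s) ^- (m + n).+1.
Proof.
move=> l0 s1; have s0 : 0 < 1 + s by lra.
rewrite -(Rintegral_wexp _ l0 s0) -L1_RintegralZ; last exact: in_L1_wexp.
by apply: eq_Rintegral => x _; rewrite -mulrA wexpM; ring.
Qed.

(** The binomial formula. *)
Lemma wexp_add lambda s n x y :
  wexp lambda s n (x + y) =
  \sum_(k < n.+1) wexp lambda s k x * wexp lambda s (n - k) y.
Proof.
rewrite {1}/wexp (mulrDr lambda) (addrC (lambda * x)) exprDn mulr_suml mulr_suml.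
apply: eq_bigr => k _; have kn : (k <= n)%N by rewrite -ltnS.
have h : n`!%:R = 'C(n, k)%:R * (k`!%:R * (n - k)`!%:R) :> R.
  by rewrite -!natrM bin_fact.
rewrite /wexp mulrDr opprD expRD -mulr_natr h; field.
by rewrite !fact_neq0 pnatr_eq0 -lt0n bin_gt0.
Qed.

Lemma corr_wexp lambda n f x : 0 < lambda -> in_L1 f -> D x ->
  corr f (fun x => lambda * wexp lambda 1 n x) x =
  \sum_(k < n.+1) lambda * wexp lambda 1 k x * pairing f (wexp lambda 1 (n - k)).
Proof.
move=> l0 fL Dx.
have wL k := in_L1M fL (wexp_test k l0 (lexx (1 : R))).
under eq_bigr do rewrite /pairing -(L1_RintegralZ _ (wL _)).
rewrite -Rintegral_sum; last by move=> k; apply: in_L1Z; exact: wL.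
apply: eq_Rintegral => y _; rewrite wexp_add !mulr_sumr.
by apply: eq_bigr => k _; ring.
Qed.

Lemma sum_triangle N (F : nat -> nat -> R) :
  \sum_(n < N.+1) \sum_(k < n.+1) F n k =
  \sum_(k < N.+1) \sum_(j < (N - k).+1) F (k + j)%N k.
Proof.
elim: N => [|N ih]; first by rewrite !big_ord1.
rewrite big_ord_recr/= ih [in RHS]big_ord_recr/= subnn big_ord1 addn0.
rewrite [X in _ + X = _]big_ord_recr/= addrA; congr (_ + _).
rewrite -big_split/=; apply: eq_bigr => k _.
have kN : (k <= N)%N by rewrite -ltnS.
by rewrite subSn// [RHS]big_ord_recr/= addnS subnKC.
Qed.

(** Once its first argument is fixed, [corr] maps exponential polynomials to
    exponential polynomials, whatever the first argument is: expanding
    (x + y)^n separates the variables.  In the numbering from the top degree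
    the operator is a power series in the shift of the coefficients. *)
Lemma corr_rev_exp_poly lambda N (b : nat -> R) f x : 0 < lambda -> in_L1 f -> D x ->
  corr f (rev_exp_poly lambda N b) x =
  rev_exp_poly lambda N (conv (fun j => pairing f (wexp lambda 1 j)) b) x.
Proof.
move=> l0 fL Dx; rewrite /rev_exp_poly exp_polyE.
transitivity (\sum_(n < N.+1) b (N - n)%N * corr f (fun x => lambda * wexp lambda 1 n x) x).
  have eL n : in_L1 (fun y => f y * (lambda * wexp lambda 1 n (x + y))).
    apply: (@in_L1M R (lambda * 1)) => //; split.
      apply: measurable_funM; first exact: measurable_cst.
      apply: measurable_shift => //; apply: measurable_wexp; exact: measurable_half_line.
    move=> y Dy; rewrite (normrM lambda) (gtr0_norm l0); apply: ler_wpM2l; first exact: ltW.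
    by apply: (wexp_test n l0 (lexx (1 : R))).2; exact: half_lineD.
  under eq_bigr do rewrite /corr -(L1_RintegralZ _ (eL _)).
  rewrite -Rintegral_sum; last by move=> n; exact: in_L1Z.
  apply: eq_Rintegral => y _; rewrite exp_polyE mulr_sumr.
  by apply: eq_bigr => n _; ring.
under eq_bigr => n _ do rewrite corr_wexp// mulr_sumr.
rewrite (sum_triangle N (fun n k => b (N - n)%N *
  (lambda * wexp lambda 1 k x * pairing f (wexp lambda 1 (n - k))))).
apply: eq_bigr => k _; rewrite /conv mulr_suml; apply: eq_bigr => j _.
by rewrite addKn subnDA; ring.
Qed.

End ExpPoly.

(** * The solution is an exponential polynomial *)

Lemma cvg_fsum (R : realType) (T : Type) (F : set_system T) (FF : Filter F) n
    (h : 'I_n -> T -> R) (l : 'I_n -> R) :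
  (forall i, h i x @[x --> F] --> l i) ->
  \sum_(i < n) h i x @[x --> F] --> \sum_(i < n) l i.
Proof.
move=> hl; apply: cvg_big => //.
by move=> x; exact: add_continuous.
Qed.

Section Form.
Context {R : realType}.
Implicit Types (lambda x s t T : R) (N n k j : nat).
Local Notation mu := (@lebesgue_measure R).
Local Notation D := (half_line R).
Let mD : measurable D := @measurable_half_line R.

Lemma prob_density_norm (f : R -> R) : prob_density f -> L1_norm f = 1%E.
Proof.
move=> [fL f0 f1]; rewrite -f1; have mf := in_L1_measurable fL.
apply: ae_eq_integral => //.
- by apply/measurable_EFinP; apply: measurableT_comp.
- exact/measurable_EFinP.
- move: f0; apply: filterS; first exact: (ae_filter_ringOfSetsType mu).
  by move=> x fx Dx; rewrite ger0_norm//; exact: fx.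
Qed.

Lemma L1_normB (f g : R -> R) : in_L1 f -> in_L1 g ->
  fine (L1_norm (fun x => f x - g x)) <= fine (L1_norm f) + fine (L1_norm g).
Proof.
move=> fL gL; rewrite !L1_norm_Rintegral//; last exact: in_L1B.
rewrite -L1_RintegralD; [|exact: L1_norm_abs|exact: L1_norm_abs].
apply: L1_le_Rintegral.
- exact/L1_norm_abs/in_L1B.
- by apply: in_L1D; exact: L1_norm_abs.
- by move=> x _; exact: ler_normB.
Qed.

Lemma L1_norm_exp_poly lambda N (c : 'I_N.+1 -> R) : 0 < lambda ->
  fine (L1_norm (exp_poly lambda c)) <= \sum_(n < N.+1) `|c n|.
Proof.
move=> l0; have cL := in_L1_exp_poly c l0.
rewrite L1_norm_Rintegral// -(Rintegral_exp_poly (fun n : 'I_N.+1 => `|c n|) l0).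
apply: L1_le_Rintegral; [exact: L1_norm_abs|exact: in_L1_exp_poly|move=> x Dx].
rewrite !exp_polyE; apply: le_trans (ler_norm_sum _ _ _) _.
apply: ler_sum => n _; rewrite normrM [X in _ * X <= _]ger0_norm//.
rewrite mulr_ge0 ?(ltW l0)// wexp_ge0//.
by move: Dx; rewrite half_lineE => /ltW.
Qed.

Lemma continuous_ext0_id (f : R -> R) : continuous f -> continuous (ext0 f).
Proof.
by move=> cf; apply: continuous_ext0 => t _; apply: cvg_within_filter; exact: cf.
Qed.

(** The triangular linear system is solved row by row, each row being an
    integral of the previous ones. *)
Lemma iterated_primitives (a : nat -> R -> R) (r0 : nat -> R) K :
  (forall j, continuous (a j)) ->
  exists r : nat -> R -> R, forall k, (k < K)%N ->
    [/\ r k 0 = r0 k, continuous (r k) & forall t : R, 0 < t ->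
      is_derive t 1 (r k) (2 * \sum_(j < k) a j.+1 t * r (k - j.+1)%N t)].
Proof.
move=> ca; elim: K => [|K [r hr]]; first by exists (fun _ _ => 0).
have cf : continuous (fun t => 2 * \sum_(j < K) a j.+1 t * r (K - j.+1)%N t).
  move=> t; apply: cvgMr.
  apply: (@cvg_fsum _ _ (nbhs t) _ _ (fun (j : 'I_K) s => a j.+1 s * r (K - j.+1)%N s)
    (fun j : 'I_K => a j.+1 t * r (K - j.+1)%N t)) => j.
  apply: cvgM; first exact: ca.
  have /hr[_ cr _] : (K - j.+1 < K)%N by rewrite ltn_subrL /= (leq_trans _ (ltn_ord j)).
  exact: cr.
have [F [F0 cF dF]] := primitive_exists cf.
exists (fun k => if k == K then fun t => r0 K + F t else r k) => k.
have eqs m t : (m <= K)%N ->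
    \sum_(j < m) a j.+1 t * (if (m - j.+1)%N == K then fun t => r0 K + F t else r (m - j.+1)%N) t =
    \sum_(j < m) a j.+1 t * r (m - j.+1)%N t.
  move=> mK; apply: eq_bigr => j _; rewrite ltn_eqF// (leq_trans _ mK)//.
  by rewrite ltn_subrL /= (leq_trans _ (ltn_ord j)).
rewrite ltnS leq_eqVlt => /predU1P[->|kK].
  rewrite eqxx; split; first by rewrite F0 addr0.
  - by move=> t; apply: cvgD; [exact: cvg_cst|exact: cF].
  - move=> t t0; rewrite eqs// -[X in is_derive _ _ _ X]add0r.
    by apply: is_derive_fD; exact: dF.
rewrite (ltn_eqF kK); have [rk0 crk drk] := hr k kK; split=> // t t0.
by rewrite eqs ?(ltnW kK)//; exact: drk.
Qed.

Lemma weak_derivative_rev_exp_poly lambda N (b db : nat -> R -> R) : 0 < lambda ->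
  (forall k, (k <= N)%N -> continuous (b k)) ->
  (forall k, (k <= N)%N -> forall t : R, 0 < t -> is_derive t 1 (b k) (db k t)) ->
  weak_derivative (fun s => rev_exp_poly lambda N (b^~ s))
                  (fun s => rev_exp_poly lambda N (db^~ s)).
Proof.
move=> l0 cb hb M psi tpsi.
pose P n := pairing (fun x => lambda * wexp lambda 1 n x) psi.
have E s : pairing (rev_exp_poly lambda N (b^~ s)) psi =
    \sum_(n < N.+1) b (N - n)%N s * P n by exact: pairing_exp_poly tpsi.
have -> : (fun s => pairing (rev_exp_poly lambda N (b^~ s)) psi) =
    fun s => \sum_(n < N.+1) b (N - n)%N s * P n by apply/funext.
split.
- apply: continuous_ext0_id => t.
  apply: (@cvg_fsum _ _ (nbhs t) _ _ (fun (n : 'I_N.+1) s => b (N - n)%N s * P n)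
    (fun n : 'I_N.+1 => b (N - n)%N t * P n)) => n.
  by apply: cvgMl; apply: cb; exact: leq_subr.
- move=> t t0; apply: is_derive_ext0 => //.
  rewrite (pairing_exp_poly _ l0 tpsi); apply: is_derive_fsum => n.
  by apply: is_derive_fZr; apply: hb => //; exact: leq_subr.
Qed.

(** The two sides are the right-hand sides of one and the same linear equation
    v' = -v + 2 corr p v, applied to p and to an exponential polynomial; the
    operator has norm at most 3 because p has norm 1. *)
Lemma evol_dist lambda N (b : nat -> R) (p dp : R -> R) : 0 < lambda ->
  prob_density p -> in_L1 dp -> eq_L1 dp (evol_rhs p) ->
  fine (L1_norm (fun x => dp x - rev_exp_poly lambda N
    (fun k => - b k + 2 * conv (fun j => pairing p (wexp lambda 1 j)) b k) x)) <=
  3 * fine (L1_norm (fun x => p x - rev_exp_poly lambda N b x)).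
Proof.
move=> l0 pP dpL dpE; have [pL _ _] := pP.
pose a j := pairing p (wexp lambda 1 j).
set q := rev_exp_poly lambda N b.
set dq := rev_exp_poly lambda N (fun k => - b k + 2 * conv a b k).
have qL : in_L1 q by exact: in_L1_exp_poly.
have dqL : in_L1 dq by exact: in_L1_exp_poly.
have uL := in_L1B pL qL.
have dqE x : D x -> dq x = - q x + 2 * corr p q x.
  move=> Dx; rewrite corr_rev_exp_poly// /dq /q /rev_exp_poly !exp_polyE.
  rewrite mulr_sumr -sumrN -big_split; apply: eq_bigr => n _ /=; ring.
have mac := measurable_abs_corr (in_L1_measurable pL) (in_L1_measurable uL).
have ac0 x : (0 <= abs_corr p (fun x => (p x - q x)%R) x)%E.
  by apply: integral_ge0 => y _; rewrite lee_fin mulr_ge0.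
rewrite -lee_fin EFinM !fineK ?L1_norm_fin//; last exact: in_L1B.
pose g x := (`|p x - q x|%:E + 2%:E * abs_corr p (fun x => (p x - q x)%R) x)%E.
apply: (@le_trans _ _ (\int[mu]_(x in D) g x)%E).
  have mu2 : measurable_fun D (fun x => 2%:E * abs_corr p (fun x => (p x - q x)%R) x)%E.
    exact: measurable_funeM.
  have mu1 : measurable_fun D (fun x => `|p x - q x|%:E).
    by apply/measurable_EFinP; exact: in_L1_measurable (L1_norm_abs uL).
  apply: ae_ge0_le_integral => //.
  - by apply/measurable_EFinP; exact: in_L1_measurable (L1_norm_abs (in_L1B dpL dqL)).
  - by move=> x _; rewrite adde_ge0// mule_ge0.
  - exact: emeasurable_funD.
  - move: dpE; apply: filterS; first exact: (ae_filter_ringOfSetsType mu).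
    move=> x dpx Dx; rewrite dpx// dqE// /evol_rhs -/(corr p p x).
    have := corr_dist pL (in_L1_measurable pL) (exp_poly_test _ l0 : bounded_test _ q) Dx.
    move=> h; rewrite /g.
    apply: (@le_trans _ _ (`|p x - q x|%:E + 2%:E * `|corr p p x - corr p q x|%:E)%E).
      rewrite -EFinM -EFinD lee_fin.
      have -> : - p x + 2 * corr p p x - (- q x + 2 * corr p q x) =
        - (p x - q x) + 2 * (corr p p x - corr p q x) by ring.
      by rewrite (le_trans (ler_normD _ _))// normrN normrM ger0_norm.
    by rewrite leeD2l// lee_wpmul2l.
rewrite /g ge0_integralD//.
- rewrite ge0_integralZl//.
  have := abs_corr_norm pL uL; rewrite (prob_density_norm pP) mul1e => h.
  apply: (@le_trans _ _ (L1_norm (fun x => (p x - q x)%R) +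
      2%:E * L1_norm (fun x => (p x - q x)%R))%E).
    by rewrite leeD2l// lee_wpmul2l.
  rewrite -(fineK (L1_norm_fin uL)) -!EFinM -EFinD lee_fin le_eqVlt.
  by apply/orP; left; apply/eqP; ring.
- by apply/measurable_EFinP; exact: in_L1_measurable (L1_norm_abs uL).
- by move=> x _; rewrite mule_ge0.
- exact: measurable_funeM.
Qed.

End Form.

Section Solution.
Context {R : realType}.
Implicit Types (lambda x s t T : R) (N n k j : nat).
Local Notation mu := (@lebesgue_measure R).
Local Notation D := (half_line R).

Lemma continuous_bounded_sum N (f : nat -> R -> R) T :
  (forall k, (k <= N)%N -> continuous (f k)) ->
  exists B : R, forall s, 0 <= s <= T -> \sum_(n < N.+1) `|f (N - n)%N s| <= B.
Proof.
move=> cf; have [T0|T0] := leP 0 T; last first.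
  by exists 0 => s /andP[s0 sT]; have := le_lt_trans (le_trans s0 sT) T0; rewrite ltxx.
have [|c _ hc] := @EVT_max R (fun s => \sum_(n < N.+1) `|f (N - n)%N s|) 0 T T0.
  apply: continuous_subspaceT => t.
  apply: (@cvg_fsum _ _ (nbhs t) _ _ (fun (n : 'I_N.+1) s => `|f (N - n)%N s|)
    (fun n : 'I_N.+1 => `|f (N - n)%N t|)) => n.
  by apply: cvg_norm; apply: cf; exact: leq_subr.
by eexists => s sT; apply: hc; rewrite in_itv.
Qed.

Lemma continuous_overlap lambda j (p : R -> R -> R) : 0 < lambda ->
  evol_solution p ->
  continuous (ext0 (fun s => pairing (p s) (wexp lambda 1 j))).
Proof.
move=> l0 [pP [dp [dpL pd _ _]]].
have pL s : 0 <= s -> in_L1 (p s) by move=> /pP[].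
by have [] := weak_derivative_L1 pL dpL pd (wexp_test j l0 (lexx (1 : R))).
Qed.

(** Freeze the solution p in the first argument of the quadratic term.  The
    resulting linear equation has p as a solution, and also an exponential
    polynomial q with the same initial value, whose coefficients solve a
    triangular system; by uniqueness p = q.  The diagonal of the system is
    absorbed in the common factor E, which leaves the coefficients relative to E
    as iterated primitives. *)
Lemma solution_form lambda N (c0 : 'I_N.+1 -> R) (p : R -> R -> R) : 0 < lambda ->
  evol_solution p -> eq_L1 (p 0) (exp_poly lambda c0) ->
  let a j := ext0 (fun s => pairing (p s) (wexp lambda 1 j)) in
  exists E : R -> R, exists r : nat -> R -> R,
  [/\ forall t, 0 < E t,
      forall n : 'I_N.+1, E 0 * r (N - n)%N 0 = c0 n,
      forall k, (k <= N)%N -> continuous (r k),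
      forall k, (k <= N)%N -> forall t, 0 < t ->
        is_derive t 1 (r k) (2 * \sum_(j < k) a j.+1 t * r (k - j.+1)%N t) &
      forall t, 0 <= t ->
        eq_L1 (p t) (rev_exp_poly lambda N (fun k => E t * r k t))].
Proof.
move=> l0 hp pinit a; have [pP [dp [dpL pd _ dpE]]] := hp.
have pL s : 0 <= s -> in_L1 (p s) by move=> /pP[].
have wp := weak_derivative_L1 pL dpL pd.
have ca j : continuous (a j) by exact: continuous_overlap hp.
have [A [A0 cA dA]] := primitive_exists (ca 0).
have [r hr] := iterated_primitives (fun k => c0 (inord (N - k))) N.+1 ca.
pose E t := expR (2 * A t - t).
have cE : continuous E.
  move=> t; apply: (@continuous_comp _ _ _ (fun t => 2 * A t - t) expR);
    last exact: continuous_expR.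
  by apply: cvgB; [apply: cvgMr; exact: cA|exact: cvg_id].
have dE t : 0 < t -> is_derive t 1 E ((2 * a 0 t - 1) * E t).
  move=> t0; apply: is_derive_expRf.
  by apply: is_derive_fB; apply: is_derive_fZ; exact: dA.
have E0 : E 0 = 1 by rewrite /E A0 mulr0 subr0 expR0.
pose b k t := E t * r k t.
pose db k t := - b k t + 2 * conv (a^~ t) (b^~ t) k.
have cb k : (k <= N)%N -> continuous (b k).
  by move=> kN t; have [_ cr _] := hr k kN; apply: cvgM; [exact: cE|exact: cr].
have hb k : (k <= N)%N -> forall t, 0 < t -> is_derive t 1 (b k) (db k t).
  move=> kN t t0; have [_ _ drk] := hr k kN.
  apply: (is_derive_eq (is_derive_fM (dE t t0) (drk t t0))).
  rewrite /db /conv big_ord_recl subn0 /b.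
  under [in RHS]eq_bigr => j _ do rewrite mulrCA.
  by rewrite -mulr_sumr; ring.
have wq := weak_derivative_rev_exp_poly l0 cb hb.
pose q s := rev_exp_poly lambda N (b^~ s).
pose dq s := rev_exp_poly lambda N (db^~ s).
have qL s : in_L1 (q s) by exact: in_L1_exp_poly.
have dqL s : in_L1 (dq s) by exact: in_L1_exp_poly.
have wu := weak_derivativeB pL dpL (fun s _ => qL s) (fun s _ => dqL s) wp wq.
have norm_du s : 0 <= s -> fine (L1_norm (fun x => dp s x - dq s x)) <=
    3 * fine (L1_norm (fun x => p s x - q s x)).
  move=> s0.
  have -> : dq s = rev_exp_poly lambda N (fun k => - b k s +
      2 * conv (fun j => pairing (p s) (wexp lambda 1 j)) (b^~ s) k).
    rewrite /dq; congr (rev_exp_poly _ _ _); apply/funext => k.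
    rewrite /db /conv; congr (_ + 2 * _); apply: eq_bigr => j _.
    by rewrite /a ext0E.
  exact: evol_dist (pP s s0) (dpL s s0) (dpE s s0).
have bnd T : exists B : R, forall s, 0 <= s <= T ->
    fine (L1_norm (fun x => p s x - q s x)) <= B.
  have [B hB] := continuous_bounded_sum T cb.
  exists (1 + B) => s /andP[s0 sT].
  apply: le_trans (L1_normB (pL s s0) (qL s)) _.
  rewrite (prob_density_norm (pP s s0)) /=; apply: lerD => //.
  by apply: le_trans (L1_norm_exp_poly _ l0) _; apply: hB; rewrite s0.
have c0E (n : 'I_N.+1) : E 0 * r (N - n)%N 0 = c0 n.
  rewrite E0 mul1r; have [//|-> _ _] := hr (N - n)%N; first by rewrite ltnS leq_subr.
  by rewrite subKn ?inord_val// -ltnS.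
have u0 : eq_L1 (fun x => p 0 x - q 0 x) (cst 0).
  move: pinit; apply: filterS; first exact: (ae_filter_ringOfSetsType mu).
  move=> x + Dx => /(_ Dx) ->; rewrite /q /rev_exp_poly !exp_polyE.
  apply/eqP; rewrite subr_eq0; apply/eqP/eq_bigr => n _.
  by rewrite /b c0E.
have three0 : 0 < 3 :> R by [].
have uL s : 0 <= s -> in_L1 (fun x => p s x - q s x).
  by move=> s0; apply: in_L1B; [exact: pL|exact: qL].
have duL s : 0 <= s -> in_L1 (fun x => dp s x - dq s x).
  by move=> s0; apply: in_L1B; [exact: dpL|exact: dqL].
have uniq := weak_gronwall three0 uL duL wu norm_du bnd u0.
exists E, r; split.
- by move=> t; exact: expR_gt0.
- exact: c0E.
- by move=> k kN; have [] := hr k kN.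
- by move=> k kN; have [] := hr k kN.
- move=> t t0; move: (uniq t t0); apply: filterS; first exact: (ae_filter_ringOfSetsType mu).
  by move=> x + Dx => /(_ Dx) /eqP; rewrite subr_eq0 => /eqP.
Qed.

End Solution.

(** * Asymptotics of the triangular system *)

Section Asymptotics.
Context {R : realType}.
Implicit Types (t s x y : R) (k n j m : nat) (f g : R -> R).

Lemma derive_bound_pow f df (C : R) m : 0 <= C -> continuous f ->
  (forall t, 0 < t -> is_derive t 1 f (df t)) ->
  (forall t, 0 < t -> `|df t| <= C * (1 + t) ^+ m) ->
  forall t, 0 <= t -> `|f t| <= (`|f 0| + C) * (1 + t) ^+ m.+1.
Proof.
move=> C0 cf hf hC t; rewrite le_eqVlt => /predU1P[<-|t0].
  by rewrite addr0 expr1n mulr1 lerDl.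
have [||c] := @MVT R f df 0 t t0.
- by move=> x; rewrite in_itv/= => /andP[x0 _]; exact: hf.
- exact: continuous_subspaceT.
rewrite in_itv/= subr0 => /andP[c0 ct] E.
have t1 : 1 <= 1 + t by rewrite lerDl ltW.
rewrite -(subrK (f 0) (f t)) E.
apply: le_trans (ler_normD _ _) _; rewrite mulrDl addrC; apply: lerD.
  by rewrite ler_peMr// exprn_ege1.
rewrite normrM (gtr0_norm t0) exprSr mulrA; apply: ler_pM => //.
- exact: ltW.
- apply: le_trans (hC c c0) _; apply: ler_wpM2l => //.
  by apply: lerXn2r; rewrite ?nnegrE ?addr_ge0 ?(ltW c0) ?(ltW t0)// lerD2l ltW.
- by rewrite lerDr.
Qed.

Lemma constant_of_derive0 f : continuous f ->
  (forall t, 0 < t -> is_derive t 1 f 0) -> forall t, 0 <= t -> f t = f 0.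
Proof.
move=> cf hf t; rewrite le_eqVlt => /predU1P[<-//|t0].
have [||c] := @MVT R f (fun=> 0) 0 t t0.
- by move=> x; rewrite in_itv/= => /andP[x0 _]; exact: hf.
- exact: continuous_subspaceT.
by move=> _; rewrite mul0r => /eqP; rewrite subr_eq0 => /eqP.
Qed.

(** Averaging: the mean of a function over [0, t] has the limit of the
    function. *)
Lemma cvg_div_id f df (l : R) : continuous f ->
  (forall t, 0 < t -> is_derive t 1 f (df t)) ->
  df t @[t --> +oo] --> l -> f t / t @[t --> +oo] --> l.
Proof.
move=> cf hf dfl; apply/cvgrPdist_le => e e0.
have e20 : 0 < e / 2 by rewrite divr_gt0.
move/cvgrPdist_le : dfl => /(_ _ e20) [T0 [_ hT0]].
pose T := Num.max 1 T0.
have T_gt0 : 0 < T by rewrite lt_max ltr01.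
have T0T : T0 <= T by rewrite le_max lexx orbT.
pose K := `|f T - l * T|.
near=> t.
have Tt : T < t by near: t; exact: nbhs_pinfty_gt (num_real _).
have t0 : 0 < t by exact: lt_trans Tt.
have Kt : K * (2 / e) <= t by near: t; exact: nbhs_pinfty_ge (num_real _).
have [||c] := @MVT R (fun t => f t - l * t) (fun t => df t - l) T t Tt.
- move=> x; rewrite in_itv/= => /andP[Tx _].
  apply: is_derive_fB; first by apply: hf; exact: lt_trans Tx.
  by apply: (is_derive_eq (is_derive_fZ l (is_derive_id x 1))); rewrite mulr1.
- apply: continuous_subspaceT => x; apply: cvgB; first exact: cf.
  by apply: cvgMr; exact: cvg_id.
rewrite in_itv/= => /andP[Tc _] E.
have h1 : `|df c - l| <= e / 2 by rewrite distrC; apply: hT0; exact: le_lt_trans Tc.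
have -> : l - f t / t = - ((f t - l * t - (f T - l * T)) + (f T - l * T)) / t.
  by field; rewrite gt_eqF.
rewrite E normrM normfV normrN (gtr0_norm t0) ler_pdivrMr//.
apply: le_trans (ler_normD _ _) _; rewrite -/K normrM.
have h2 : `|df c - l| * `|t - T| <= e / 2 * t.
  apply: ler_pM => //; rewrite ger0_norm; lra.
have h3 : K <= e / 2 * t.
  have -> : K = e / 2 * (K * (2 / e)) by field; rewrite gt_eqF.
  by rewrite ler_pM2l.
by lra.
Unshelve. all: by end_near. Qed.

Variables (N : nat) (a : nat -> R -> R) (E : R -> R) (r : nat -> R -> R) (delta : R).
Hypothesis ca : forall j, continuous (a j).
Hypothesis a_le1 : forall j t, 0 <= t -> `|a j t| <= 1.
Hypothesis delta0 : 0 < delta.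
Hypothesis a1_ge : forall t, 0 <= t -> delta <= a 1%N t.
Hypothesis cr : forall k, (k <= N)%N -> continuous (r k).
Hypothesis dr : forall k, (k <= N)%N -> forall t, 0 < t ->
  is_derive t 1 (r k) (2 * \sum_(j < k) a j.+1 t * r (k - j.+1)%N t).
Hypothesis r00 : r 0%N 0 != 0.
Hypothesis sumE : forall t, 0 <= t -> \sum_(n < N.+1) E t * r (N - n)%N t = 1.
Hypothesis a1E : forall t, 0 <= t ->
  a 1%N t = \sum_(n < N.+1) E t * r (N - n)%N t * (n.+1%:R * 2 ^- n.+2).

Lemma r0_cst t : 0 <= t -> r 0%N t = r 0%N 0.
Proof.
apply: constant_of_derive0; first exact: cr.
by move=> s s0; have := dr (leq0n N) s0; rewrite big_ord0 mulr0.
Qed.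

(** Each integration contributes at most one power of t. *)
Lemma r_growth K : exists2 C : R, 0 <= C & forall k, (k < K)%N -> (k <= N)%N ->
  forall t, 0 <= t -> `|r k t| <= C * (1 + t) ^+ k.
Proof.
elim: K => [|K [C C0 hC]]; first by exists 0.
have [KN|KN] := leqP K N; last first.
  exists C => // k; rewrite ltnS leq_eqVlt => /predU1P[->|]; last exact: hC.
  by rewrite leqNgt KN.
suff [C' C'0 hC'] : exists2 C' : R, 0 <= C' &
    forall t, 0 <= t -> `|r K t| <= C' * (1 + t) ^+ K.
  exists (C + C'); first exact: addr_ge0.
  move=> k; rewrite ltnS leq_eqVlt => /predU1P[->|kK] kN t t0.
    by apply: le_trans (hC' t t0) _; rewrite ler_wpM2r ?lerDr// exprn_ge0// addr_ge0.
  by apply: le_trans (hC k kK kN t t0) _; rewrite ler_wpM2r ?lerDl// exprn_ge0// addr_ge0.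
case: K KN hC => [|K] KN hC.
  by exists `|r 0%N 0| => // t t0; rewrite expr0 mulr1 r0_cst.
exists (`|r K.+1 0| + 2 * \sum_(j < K.+1) C); first by rewrite addr_ge0// mulr_ge0// sumr_ge0.
apply: (derive_bound_pow _ (cr KN) (dr KN)); first by rewrite mulr_ge0// sumr_ge0.
move=> t t0; rewrite normrM ger0_norm// -mulrA; apply: ler_wpM2l => //.
apply: le_trans (ler_norm_sum _ _ _) _; rewrite mulr_suml; apply: ler_sum => j _.
have jK : (K.+1 - j.+1 <= K)%N by rewrite subSS leq_subr.
rewrite normrM -[leRHS]mul1r; apply: ler_pM => //; first by apply: a_le1; exact: ltW.
apply: le_trans (hC _ _ _ _ (ltW t0)) _.
- by rewrite ltnS.
- exact: leq_trans jK (ltnW KN).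
- by apply: ler_wpM2l => //; apply: ler_weXn2l => //; rewrite lerDl ltW.
Qed.

(** The clock th, the integral of 2 a_1, runs at a speed between 2 delta
    and 2. *)
Lemma theta_exists : exists th : R -> R, [/\ th 0 = 0, continuous th,
  forall t, 0 < t -> is_derive t 1 th (2 * a 1%N t) &
  forall t, 0 <= t -> 2 * delta * t <= th t <= 2 * t].
Proof.
have [F [F0 cF dF]] := primitive_exists (@ca 1%N).
have cth : continuous (fun t => 2 * F t) by move=> t; apply: cvgMr; exact: cF.
have dth t : 0 < t -> is_derive t 1 (fun t => 2 * F t) (2 * a 1%N t).
  by move=> t0; apply: is_derive_fZ; exact: dF.
have lin (k : R) : continuous (fun t => k * t) /\
    forall t, is_derive t 1 (fun t => k * t) k.
  split; first by move=> t; apply: cvgMr; exact: cvg_id.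
  by move=> t; apply: (is_derive_eq (is_derive_fZ k (is_derive_id t 1))); rewrite mulr1.
exists (fun t => 2 * F t); split=> //; first by rewrite F0 mulr0.
move=> t t0; have dth' s : 0 < s < t -> is_derive s 1 (fun t => 2 * F t) (2 * a 1%N s).
  by move=> /andP[s0 _]; exact: dth.
apply/andP; split.
- have [cl dl] := lin (2 * delta).
  apply: (le_of_derive_le t0 cl cth (fun s _ => dl s) dth').
  + by move=> s /andP[s0 _]; apply: ler_wpM2l => //; apply: a1_ge; exact: ltW.
  + by rewrite F0 !mulr0.
- have [cl dl] := lin 2.
  apply: (le_of_derive_le t0 cth cl dth' (fun s _ => dl s)).
  + move=> s /andP[s0 _]; rewrite ger_pMr//.
    exact: le_trans (ler_norm _) (a_le1 _ (ltW s0)).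
  + by rewrite F0 !mulr0.
Qed.

(** In the system for r the terms with a_2, a_3, ... lose one power of t against
    the term with a_1, and a_1 alone would give exactly powers of the clock. *)
Lemma r_expansion (th : R -> R) : th 0 = 0 -> continuous th ->
  (forall t, 0 < t -> is_derive t 1 th (2 * a 1%N t)) ->
  (forall t, 0 <= t -> 2 * delta * t <= th t <= 2 * t) ->
  forall m, (m < N)%N -> exists2 C : R, 0 <= C &
    forall t, 0 <= t -> `|r m.+1 t - r 0%N 0 * (th t ^+ m.+1 / m.+1`!%:R)| <= C * (1 + t) ^+ m.
Proof.
move=> th0 cth dth hth.
have [B B0 hB] := r_growth N.+1.
pose e k t := r k t - r 0%N 0 * (th t ^+ k / k`!%:R).
have ce k : (k <= N)%N -> continuous (e k).
  move=> kN t; apply: cvgB; first exact: cr.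
  apply: cvgMr; apply: cvgMl.
  by apply: (@continuous_comp _ _ _ th (fun x => x ^+ k)); [exact: cth|exact: exprn_continuous].
have de k : (k < N)%N -> forall t, 0 < t -> is_derive t 1 (e k.+1)
    (2 * (a 1%N t * e k t + \sum_(j < k) a j.+2 t * r (k - j.+1)%N t)).
  move=> kN t t0; have h := is_derive_fZr (k.+1)`!%:R^-1 (is_derive_fX k.+1 (dth t t0)).
  apply: (is_derive_eq (is_derive_fB (dr kN t0) (is_derive_fZ (r 0%N 0) h))).
  rewrite big_ord_recl /= subSS subn0 /e.
  under eq_bigr => j _ do rewrite /bump /= add1n subSS.
  rewrite factS natrM; field.
  by rewrite fact_neq0 lt0r_neq0// ltr_wpDr.
elim=> [|m ih] mN.
  exists `|e 1%N 0| => // t t0; rewrite expr0 mulr1 -/(e 1%N t).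
  rewrite (_ : e 1%N t = e 1%N 0)//; apply: constant_of_derive0 => //; first exact: ce.
  move=> s s0; apply: (is_derive_eq (de 0%N mN s s0)).
  by rewrite big_ord0 addr0 /e (r0_cst (ltW s0)) expr0 fact0 divr1 mulr1 subrr !mulr0.
have [C C0 hC] := ih (ltnW mN).
pose C' := 2 * (C + \sum_(j < m.+1) B).
have C'0 : 0 <= C' by rewrite mulr_ge0// addr_ge0// sumr_ge0.
exists (`|e m.+2 0| + C'); first by rewrite addr_ge0.
apply: (derive_bound_pow C'0 (ce _ mN) (de _ mN)) => t t0.
have t1 : 1 <= 1 + t by rewrite lerDl ltW.
rewrite normrM ger0_norm// /C' -mulrA; apply: ler_wpM2l => //.
apply: le_trans (ler_normD _ _) _; rewrite mulrDl; apply: lerD.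
  rewrite normrM -[leRHS]mul1r; apply: ler_pM => //; first by apply: a_le1; exact: ltW.
  by apply: hC; exact: ltW.
apply: le_trans (ler_norm_sum _ _ _) _; rewrite mulr_suml; apply: ler_sum => j _.
have jm : (m.+1 - j.+1 <= m)%N by rewrite subSS leq_subr.
rewrite normrM -[leRHS]mul1r; apply: ler_pM => //; first by apply: a_le1; exact: ltW.
have mN' : (m.+1 - j.+1 <= N)%N by apply: leq_trans jm _; apply: ltnW; exact: ltnW.
apply: le_trans (hB _ mN' mN' _ (ltW t0)) _.
by apply: ler_wpM2l => //; apply: ler_weXn2l.
Qed.

Lemma r_ratio (th : R -> R) : th 0 = 0 -> continuous th ->
  (forall t, 0 < t -> is_derive t 1 th (2 * a 1%N t)) ->
  (forall t, 0 <= t -> 2 * delta * t <= th t <= 2 * t) ->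
  forall k, (k <= N)%N -> r k t / th t ^+ k @[t --> +oo] --> r 0%N 0 / k`!%:R.
Proof.
move=> th0 cth dth hth [|k] kN.
  rewrite fact0 divr1; apply: cvg_near_cst; near=> t.
  rewrite expr0 divr1 r0_cst// ltW//; near: t; exact: nbhs_pinfty_gt (num_real _).
have [C C0 hC] := r_expansion th0 cth dth hth kN.
(* chosen so that, for t >= 1, the error is at most K / t times th t ^+ k.+1 *)
pose K := C * 2 ^+ k / (2 * delta) ^+ k.+1.
have K0 : 0 <= K by rewrite divr_ge0 ?mulr_ge0 ?exprn_ge0// ltW// mulr_gt0.
apply/cvgrPdist_le => e e0; near=> t.
have t1 : 1 < t by near: t; exact: nbhs_pinfty_gt (num_real _).
have Kt : K / e <= t by near: t; exact: nbhs_pinfty_ge (num_real _).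
have t0 : 0 < t by lra.
have d0 : 0 < 2 * delta * t by rewrite !mulr_gt0.
have /andP[th_ge _] := hth t (ltW t0).
have th_gt0 : 0 < th t by exact: lt_le_trans th_ge.
rewrite distrC.
have -> : r k.+1 t / th t ^+ k.+1 - r 0%N 0 / k.+1`!%:R =
   (r k.+1 t - r 0%N 0 * (th t ^+ k.+1 / k.+1`!%:R)) / th t ^+ k.+1.
  by field; rewrite fact_neq0 expf_neq0// gt_eqF.
rewrite normrM normfV (gtr0_norm (exprn_gt0 _ th_gt0)) ler_pdivrMr ?exprn_gt0//.
apply: le_trans (hC t (ltW t0)) _.
apply: (@le_trans _ _ (C * (2 * t) ^+ k)).
  by apply: ler_wpM2l => //; apply: lerXn2r; rewrite ?nnegrE; lra.
apply: (@le_trans _ _ (e * (2 * delta * t) ^+ k.+1)); last first.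
  apply: ler_wpM2l; first exact: ltW.
  by apply: lerXn2r; rewrite ?nnegrE ?(ltW d0) ?(ltW th_gt0).
have -> : C * (2 * t) ^+ k = K / t * (2 * delta * t) ^+ k.+1.
  rewrite /K !exprMn !exprS; field.
  by rewrite !expf_neq0 ?gt_eqF.
apply: ler_wpM2r; first by rewrite exprn_ge0// ltW.
by rewrite ler_pdivrMr// mulrC -ler_pdivrMr.
Unshelve. all: by end_near. Qed.

(** The relative coefficients are asymptotic to powers of the clock, and the
    normalization of the total mass determines E.  So the coefficient of degree n
    is of order th^-n, all but the constant one vanish in the limit, a_1 tends to
    its value 1/4 at the exponential density, and th is asymptotic to t/2. *)
Lemma coeff_asymptotics n : (n <= N)%N ->
  E t * r (N - n)%N t * (t / 2) ^+ n @[t --> +oo] --> (N`!%:R / (N - n)`!%:R : R).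
Proof.
have [th [th0 cth dth hth]] := theta_exists.
have ratio := r_ratio th0 cth dth hth.
set rho := r 0%N 0 in ratio *.
have th_gt0 : \forall t \near +oo, 0 < th t.
  near=> t; have t0 : 0 < t by near: t; exact: nbhs_pinfty_gt (num_real _).
  by have /andP[+ _] := hth t (ltW t0); apply: lt_le_trans; rewrite !mulr_gt0.
have thV : (th t)^-1 @[t --> +oo] --> (0 : R).
  apply/gtr0_cvgV0 => //; apply/cvgryPge => A; near=> t.
  have t0 : 0 < t by near: t; exact: nbhs_pinfty_gt (num_real _).
  have At : A / (2 * delta) <= t by near: t; exact: nbhs_pinfty_ge (num_real _).
  have /andP[+ _] := hth t (ltW t0); apply: le_trans.
  by rewrite mulrC -ler_pdivrMr// mulr_gt0.
have thVX k : (th t)^-1 ^+ k @[t --> +oo] --> ((k == 0%N)%:R : R).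
  rewrite -expr0n; apply: (cvg_comp (fun t => (th t)^-1) (fun x => x ^+ k) thV).
  exact: exprn_continuous.
have lowT : \sum_(n < N.+1) r (N - n)%N t / th t ^+ N @[t --> +oo] --> rho / N`!%:R.
  have -> : rho / N`!%:R = \sum_(n < N.+1) (rho / (N - n)`!%:R * ((n : nat) == 0%N)%:R).
    rewrite big_ord_recl subn0 mulr1 big1 ?addr0// => i _.
    by rewrite mulr0.
  apply: (@cvg_fsum R R _ _ _ (fun (n : 'I_N.+1) t => r (N - n)%N t / th t ^+ N)
    (fun n : 'I_N.+1 => rho / (N - n)`!%:R * ((n : nat) == 0%N)%:R)) => i.
  have iN : (i <= N)%N by rewrite -ltnS.
  apply: (@cvg_trans _ (r (N - i)%N t / th t ^+ (N - i) * (th t)^-1 ^+ i @[t --> +oo])).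
    apply: near_eq_cvg; near=> t.
    have t0 : 0 < th t by near: t.
    by rewrite -mulrA exprVn -invfM -exprD subnK.
  by apply: cvgM; [apply: ratio; exact: leq_subr|exact: thVX].
have rhoN : rho / N`!%:R != 0 by rewrite mulf_neq0// invr_neq0// fact_neq0.
have EthN : E t * th t ^+ N @[t --> +oo] --> (N`!%:R / rho).
  rewrite -[X in _ --> X]invf_div.
  apply: (@cvg_trans _ ((\sum_(n < N.+1) r (N - n)%N t / th t ^+ N)^-1 @[t --> +oo])).
    apply: near_eq_cvg; near=> t.
    have t0 : 0 < t by near: t; exact: nbhs_pinfty_gt (num_real _).
    have tht : 0 < th t by near: t.
    rewrite -mulr_suml invfM invrK; congr (_ * _).
    have := sumE (ltW t0); rewrite -mulr_sumr => h.
    have S0 : \sum_(n < N.+1) r (N - n)%N t != 0.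
      by apply: contra_eq_neq h => ->; rewrite mulr0 eq_sym oner_eq0.
    by apply: (mulIf S0); rewrite mulVf.
  exact: cvgV.
have cth_n k : (k <= N)%N ->
    E t * r (N - k)%N t * th t ^+ k @[t --> +oo] --> (N`!%:R / (N - k)`!%:R : R).
  move=> kN; rewrite (_ : N`!%:R / _ = (N`!%:R / rho) * (rho / (N - k)`!%:R)); last first.
    by field; rewrite r00 fact_neq0.
  apply: (@cvg_trans _ (E t * th t ^+ N * (r (N - k)%N t / th t ^+ (N - k)) @[t --> +oo])).
    apply: near_eq_cvg; near=> t.
    have tht : 0 < th t by near: t.
    rewrite -{1}(subnK kN) exprD; field.
    by rewrite expf_neq0// gt_eqF.
  by apply: cvgM => //; apply: ratio; exact: leq_subr.
have coef k : (k <= N)%N -> E t * r (N - k)%N t @[t --> +oo] --> ((k == 0%N)%:R : R).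
  move=> kN; rewrite (_ : _%:R = N`!%:R / (N - k)`!%:R * (k == 0%N)%:R); last first.
    by case: k kN => [|k] kN; rewrite ?mulr0// subn0 mulr1 divff// fact_neq0.
  apply: (@cvg_trans _ (E t * r (N - k)%N t * th t ^+ k * (th t)^-1 ^+ k @[t --> +oo])).
    apply: near_eq_cvg; near=> t.
    have tht : 0 < th t by near: t.
    by rewrite exprVn mulfK// expf_neq0// gt_eqF.
  by apply: cvgM; [exact: cth_n|exact: thVX].
have a1_lim : a 1%N t @[t --> +oo] --> (4^-1 : R).
  have -> : 4^-1 = \sum_(n < N.+1) (((n : nat) == 0%N)%:R * (n.+1%:R * 2 ^- n.+2)) :> R.
    rewrite big_ord_recl big1 ?addr0; last by move=> i _; rewrite mul0r.
    by rewrite !mul1r expr2 -natrM.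
  apply: (@cvg_trans _ (\sum_(n < N.+1) E t * r (N - n)%N t * (n.+1%:R * 2 ^- n.+2) @[t --> +oo])).
    apply: near_eq_cvg; near=> t.
    by rewrite a1E// ltW//; near: t; exact: nbhs_pinfty_gt (num_real _).
  apply: (@cvg_fsum R R _ _ _ (fun (n : 'I_N.+1) t => E t * r (N - n)%N t * (n.+1%:R * 2 ^- n.+2))
    (fun n : 'I_N.+1 => ((n : nat) == 0%N)%:R * (n.+1%:R * 2 ^- n.+2))) => i.
  by apply: cvgMl; apply: coef; rewrite -ltnS.
have th_lim : th t / t @[t --> +oo] --> (2^-1 : R).
  apply: (cvg_div_id cth dth); rewrite (_ : 2^-1 = 2 * 4^-1 :> R); last by field.
  exact: cvgMr.
move=> nN; rewrite -[X in _ --> X]mulr1.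
have half : t / 2 / th t @[t --> +oo] --> (1 : R).
  rewrite (_ : 1 = 2^-1 * (2^-1)^-1 :> R); last by rewrite divff// invr_neq0.
  apply: (@cvg_trans _ (2^-1 * (th t / t)^-1 @[t --> +oo])).
    apply: near_eq_cvg; near=> t.
    have tht : 0 < th t by near: t.
    have t0 : 0 < t by near: t; exact: nbhs_pinfty_gt (num_real _).
    by field; rewrite !gt_eqF.
  by apply: cvgMr; apply: cvgV => //; rewrite invr_neq0.
have halfX : (t / 2 / th t) ^+ n @[t --> +oo] --> (1 : R).
  rewrite -[X in _ --> X](expr1n R n).
  apply: (cvg_comp (fun t => t / 2 / th t) (fun x => x ^+ n) half).
  exact: exprn_continuous.
apply: (@cvg_trans _ (E t * r (N - n)%N t * th t ^+ n * (t / 2 / th t) ^+ n @[t --> +oo])).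
  apply: near_eq_cvg; near=> t.
  have tht : 0 < th t by near: t.
  rewrite -(mulrA _ (th t ^+ n)) -exprMn; congr (_ * _ ^+ n); field.
  by rewrite gt_eqF.
by apply: cvgM => //; exact: cth_n.
Unshelve. all: by end_near. Qed.

End Asymptotics.

(** * Lower bound for the first overlap coefficient *)

Section LowerBound.
Context {R : realType}.
Implicit Types (lambda x : R) (N n m : nat).
Local Notation mu := (@lebesgue_measure R).
Local Notation D := (half_line R).

(** Invertibility of the Vandermonde matrix. *)
Lemma quadrature_weights N (u : 'I_N.+1 -> R) (b : 'I_N.+1 -> R) : injective u ->
  exists w : 'I_N.+1 -> R, forall m : 'I_N.+1, \sum_i w i * u i ^+ m = b m.
Proof.
move=> inju; pose V := Vandermonde N.+1 (\row_i u i).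
have Vu : V \in unitmx.
  rewrite unitmxE det_Vandermonde unitfE; apply/prodf_neq0 => i _.
  apply/prodf_neq0 => j ij; rewrite !mxE subr_eq0.
  by apply: contraTneq ij => /inju ->; rewrite ltnn.
pose w := invmx V *m (\col_i b i).
exists (fun i => w i 0) => m.
have : (V *m w) m 0 = b m by rewrite mulKVmx// mxE.
by rewrite mxE => <-; apply: eq_bigr => i _; rewrite !mxE mulrC.
Qed.

Lemma eq_L1_pairing M (f g psi : R -> R) : in_L1 f -> in_L1 g -> bounded_test M psi ->
  eq_L1 f g -> pairing f psi = pairing g psi.
Proof.
move=> fL gL tpsi fg; apply: eq_L1_Rintegral.
- exact: in_L1_measurable (in_L1M fL tpsi).
- exact: in_L1_measurable (in_L1M gL tpsi).
- exact: eq_L1M.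
Qed.

Lemma le_pairing M (f psi phi : R -> R) : prob_density f ->
  bounded_test M psi -> bounded_test M phi -> (forall x, D x -> psi x <= phi x) ->
  pairing f psi <= pairing f phi.
Proof.
move=> [fL f0 _] tpsi tphi le.
have psiL := in_L1M fL tpsi; have phiL := in_L1M fL tphi.
have nL := L1_norm_abs fL.
rewrite -subr_ge0 /pairing -L1_RintegralB//.
rewrite (@eq_L1_Rintegral _ _ (fun x => `|f x| * (phi x - psi x))).
- by apply: Rintegral_ge0 => x Dx; rewrite mulr_ge0// subr_ge0 le.
- exact: in_L1_measurable (in_L1B phiL psiL).
- apply: measurable_funM; first exact: in_L1_measurable nL.
  by apply: measurable_funB; [exact: tphi.1|exact: tpsi.1].
- move: f0; apply: filterS; first exact: (ae_filter_ringOfSetsType mu).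
  by move=> x fx Dx; rewrite ger0_norm ?mulrBr//; exact: fx.
Qed.

Lemma pairing_wexp1 lambda N (c : 'I_N.+1 -> R) (p : R -> R) (s : R) : 0 < lambda ->
  1 <= s -> in_L1 p -> eq_L1 p (exp_poly lambda c) ->
  pairing p (wexp lambda s 1) = \sum_(n < N.+1) c n * (n.+1%:R * (1 + s) ^- n.+2).
Proof.
move=> l0 s1 pL pc; have tw := wexp_test 1 l0 s1.
rewrite (eq_L1_pairing pL (in_L1_exp_poly c l0) tw pc) (pairing_exp_poly _ l0 tw).
by apply: eq_bigr => n _; rewrite pairing_wexp// addn1 bin1.
Qed.

(** For a polynomial density, s |-> [pairing p (wexp lambda s 1)] is, up to a
    power of 1 + s, a polynomial of degree N in 1/(1 + s), so its values at the
    N + 1 nodes s = 1, ..., N + 1 determine the total mass 1 through fixed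
    weights.  By positivity of p the value at s = 1 dominates all the others,
    hence cannot be small. *)
Lemma overlap_lower_bound N : exists2 delta : R, 0 < delta &
  forall lambda (c : 'I_N.+1 -> R) (p : R -> R), 0 < lambda -> prob_density p ->
    eq_L1 p (exp_poly lambda c) -> \sum_(n < N.+1) c n = 1 ->
    delta <= pairing p (wexp lambda 1 1).
Proof.
(* the node s = i + 1 enters through 1 / (1 + s) *)
pose u (i : 'I_N.+1) : R := (i.+2%:R)^-1.
have inju : injective u.
  by move=> i j /invr_inj/eqP; rewrite eqr_nat => /eqP[] /val_inj.
(* the coefficient of degree m carries the factor m + 1, which the weights undo *)
have [w hw] := quadrature_weights (fun m : 'I_N.+1 => (m.+1%:R)^-1) inju.
pose S := \sum_i `|w i| * i.+2%:R ^+ 2.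
suff key lambda (c : 'I_N.+1 -> R) (p : R -> R) : 0 < lambda -> prob_density p ->
    eq_L1 p (exp_poly lambda c) -> \sum_(n < N.+1) c n = 1 ->
    1 <= S * pairing p (wexp lambda 1 1).
  have S_ge0 : 0 <= S by apply: sumr_ge0 => i _; rewrite mulr_ge0.
  have [S0|S0] := leP S 0.
    exists 1 => // lambda c p l0 pP pc c1; have := key _ _ _ l0 pP pc c1.
    have -> : S = 0 by apply/eqP; rewrite eq_le S0.
    by rewrite mul0r ler10.
  exists S^-1; first by rewrite invr_gt0.
  move=> lambda c p l0 pP pc c1; have := key _ _ _ l0 pP pc c1.
  by rewrite -[S^-1]mul1r ler_pdivrMr// mulrC.
move=> l0 pP pc c1; have [pL _ _] := pP.
have s_ge1 (i : 'I_N.+1) : 1 <= i.+1%:R :> R by rewrite ler1n.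
rewrite -[X in X <= _]c1.
have -> : \sum_(n < N.+1) c n =
    \sum_i w i * i.+2%:R ^+ 2 * pairing p (wexp lambda i.+1%:R 1).
  under [RHS]eq_bigr => i _ do rewrite (pairing_wexp1 l0 (s_ge1 i) pL pc) mulr_sumr.
  rewrite exchange_big; apply: eq_bigr => n _ /=.
  transitivity (c n * n.+1%:R * \sum_i w i * u i ^+ n).
    by rewrite hw mulfK// pnatr_eq0.
  rewrite mulr_sumr; apply: eq_bigr => i _.
  rewrite /u nat1r exprVn (exprD _ 2 n); field.
  by rewrite expf_neq0// ?pnatr_eq0// gt_eqF// addr_gt0// ltr0Sn.
rewrite /S mulr_suml; apply: ler_sum => i _.
have tw : bounded_test 1 (wexp lambda i.+1%:R 1) := wexp_test 1 l0 (s_ge1 i).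
apply: le_trans (ler_norm _) _; rewrite normrM normrM (ger0_norm (exprn_ge0 _ _))//.
apply: ler_wpM2l; first by rewrite mulr_ge0.
rewrite ger0_norm.
- apply: (le_pairing pP tw (wexp_test 1 l0 (lexx (1 : R)))) => x.
  rewrite half_lineE => x0; rewrite /wexp; apply: ler_wpM2l.
    by rewrite divr_ge0// exprn_ge0// mulr_ge0 ?ltW.
  by rewrite ler_expR lerN2 ler_wpM2r// mulr_ge0 ?ltW.
- have -> : 0 = pairing p (fun=> 0).
    by rewrite /pairing; under eq_Rintegral do rewrite mulr0; rewrite /Rintegral integral0.
  apply: (le_pairing pP _ tw).
    by split; [exact: measurable_cst|move=> x _; rewrite normr0].
  by move=> x; rewrite half_lineE => x0; rewrite wexp_ge0// ltW.
Qed.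

End LowerBound.

(** * Pointwise limit, mean and logarithmic time *)

Section Consequences.
Context {R : realType}.
Implicit Types (lambda x t : R) (N n : nat) (f g : R -> R).
Local Notation mu := (@lebesgue_measure R).
Local Notation D := (half_line R).

(** A point of disagreement would have a neighbourhood of positive measure
    consisting of such points. *)
Lemma eq_L1_continuous f g : eq_L1 f g ->
  (forall x, D x -> {for x, continuous f}) ->
  (forall x, D x -> {for x, continuous g}) ->
  forall x, D x -> f x = g x.
Proof.
move=> [Z [mZ Z0 fgZ]] cf cg x Dx; apply: contrapT => /eqP fgx.
have h0 : f x - g x != 0 by rewrite subr_eq0.
have ch : {for x, continuous (fun y => f y - g y)} by apply: cvgB; [exact: cf|exact: cg].
have x0 : 0 < x by rewrite half_lineE in Dx.
have /nbhs_ballP[e /= e0 he] : \forall y \near x, f y - g y != 0 /\ 0 < y.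
  apply: filterI; last exact: lt_nbhsr.
  exact: (cvgr_neq0 _ ch h0).
have : (mu (ball x e) <= mu Z)%E.
  apply: le_measure; rewrite ?inE//; first exact: measurable_ball.
  move=> y /he [fgy y0]; apply: fgZ => /= fg; move: fgy.
  by rewrite fg ?half_lineE// subrr eqxx.
by rewrite Z0 lebesgue_measure_ball ?(ltW e0)// lee_fin leNgt mulrn_wgt0.
Qed.

Lemma eq_L1_euclid f g h : eq_L1 h f -> eq_L1 h g -> eq_L1 f g.
Proof.
move=> hf hg; apply: (@filterS2 _ _ (ae_filter_ringOfSetsType mu) _ _ _ _ hf hg).
by move=> x hfx hgx Dx; rewrite -hfx// hgx.
Qed.

Lemma continuous_exp_poly lambda N (c : 'I_N.+1 -> R) : continuous (exp_poly lambda c).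
Proof.
move=> x; rewrite (_ : exp_poly lambda c =
  fun x => \sum_(n < N.+1) c n * (lambda * wexp lambda 1 n x)); last first.
  by apply/funext => y; rewrite exp_polyE.
apply: (@cvg_fsum _ _ (nbhs x) _ _ (fun (n : 'I_N.+1) s => c n * (lambda * wexp lambda 1 n s))
  (fun n : 'I_N.+1 => c n * (lambda * wexp lambda 1 n x))) => n.
by apply: cvgMr; apply: cvgMr; exact: continuous_wexp.
Qed.

Lemma cvg_exp_poly lambda N (c : R -> 'I_N.+1 -> R) x :
  (forall n : 'I_N.+1, c t n @[t --> +oo] --> ((n == 0%N :> nat)%:R : R)) ->
  exp_poly lambda (c t) x @[t --> +oo] --> lambda * expR (- (lambda * x)).
Proof.
move=> hc.
have -> : lambda * expR (- (lambda * x)) =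
    \sum_(n < N.+1) (n == 0%N :> nat)%:R * (lambda * wexp lambda 1 n x).
  rewrite big_ord_recl big1 ?addr0; last by move=> i _; rewrite mul0r.
  by rewrite /wexp expr0 fact0 divr1 !mul1r.
under eq_cvg do rewrite exp_polyE.
apply: (@cvg_fsum _ _ _ _ _ (fun (n : 'I_N.+1) t => c t n * (lambda * wexp lambda 1 n x))
  (fun n : 'I_N.+1 => (n == 0%N :> nat)%:R * (lambda * wexp lambda 1 n x))) => n.
exact: cvgMl.
Qed.

Lemma mean_exp_poly lambda N (c : 'I_N.+1 -> R) f : 0 < lambda -> in_L1 f ->
  eq_L1 f (exp_poly lambda c) ->
  mean f = lambda^-1 * \sum_(n < N.+1) c n * n.+1%:R.
Proof.
move=> l0 fL fc; rewrite /mean.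
have mid : measurable_fun D (fun x => x : R) by exact: measurable_id.
rewrite (@eq_L1_Rintegral _ _ (fun x => x * exp_poly lambda c x)); first last.
- move: fc; apply: filterS; first exact: (ae_filter_ringOfSetsType mu).
  by move=> x + Dx => /(_ Dx) ->.
- by apply: measurable_funM => //; exact: in_L1_measurable (in_L1_exp_poly c l0).
- by apply: measurable_funM => //; exact: in_L1_measurable.
have wL (n : nat) := in_L1_wexp n l0 ltr01.
transitivity (\int[mu]_(x in D) \sum_(n < N.+1)
    (lambda^-1 * (c n * n.+1%:R)) * (lambda * wexp lambda 1 n.+1 x)).
  apply: eq_Rintegral => x _; rewrite exp_polyE mulr_sumr; apply: eq_bigr => n _.
  rewrite /wexp exprS factS natrM; field.
  by rewrite fact_neq0 gt_eqF//= lt0r_neq0// ltr_wpDr.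
rewrite Rintegral_sum; last by move=> n; exact: in_L1Z.
rewrite mulr_sumr; apply: eq_bigr => n _.
by rewrite L1_RintegralZ// Rintegral_wexp// expr1n invr1 mulr1.
Qed.

Lemma cvg_ln1D_infty : (ln (1 + t) : R) @[t --> +oo] --> +oo.
Proof.
apply/cvgryPge => A; near=> t.
have t0 : 0 < t by near: t; exact: nbhs_pinfty_gt (num_real _).
have At : expR A <= t by near: t; exact: nbhs_pinfty_ge (num_real _).
rewrite -(expRK A) ler_ln ?posrE ?expR_gt0//; first by lra.
by lra.
Unshelve. all: by end_near. Qed.

(** For t >= 1 the difference of the logarithms lies between 0 and ln 2. *)
Lemma cvg_ln_ratio : (ln t / ln (1 + t) : R) @[t --> +oo] --> (1 : R).
Proof.
have lnV : (ln (1 + t))^-1 @[t --> +oo] --> (0 : R).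
  apply/gtr0_cvgV0; last exact: cvg_ln1D_infty.
  near=> t; have t0 : 0 < t by near: t; exact: nbhs_pinfty_gt (num_real _).
  by apply: ln_gt0; rewrite ltrDl.
apply: (@squeeze_cvgr _ _ _ _ (fun t => 1 - ln 2 * (ln (1 + t))^-1) (fun=> 1)).
- near=> t.
  have t1 : 1 < t by near: t; exact: nbhs_pinfty_gt (num_real _).
  have t0 : 0 < t by lra.
  have L0 : 0 < ln (1 + t) by apply: ln_gt0; rewrite ltrDl.
  have h1 : ln t <= ln (1 + t) by rewrite ler_ln ?posrE//; lra.
  have h2 : ln (1 + t) <= ln 2 + ln t.
    by rewrite -lnM ?posrE// ler_ln ?posrE; lra.
  apply/andP; split; last by rewrite ler_pdivrMr// mul1r.
  rewrite ler_pdivlMr// mulrBl mul1r -mulrA mulVf ?gt_eqF// mulr1; lra.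
- rewrite -[X in _ --> X]subr0; apply: cvgB; first exact: cvg_cst.
  by rewrite -[X in _ --> X](mulr0 (ln 2)); exact: cvgMr.
- exact: cvg_cst.
Unshelve. all: by end_near. Qed.

Lemma asymp_equiv_ln (K : R) : K != 0 ->
  asymp_equiv (fun t => K * (ln (1 + t))^-1) (fun t => K * (ln t)^-1).
Proof.
move=> K0; apply: cvg_trans cvg_ln_ratio; apply: near_eq_cvg; near=> t.
by rewrite invfM invrK mulrACA mulfV// mul1r mulrC.
Unshelve. all: by end_near. Qed.

End Consequences.

(** * Rates of convergence *)

Section Rates.
Context {R : realType}.
Implicit Types (t : R) (N n k : nat).

(** The limit is written as a single formula so that the surviving degree n = k
    and the vanishing ones are treated together in sums. *)
Lemma cvg_scaled_pow (f : R -> R) n k (L : R) : (k <= n)%N ->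
  f t * (t / 2) ^+ n @[t --> +oo] --> L ->
  f t * (t / 2) ^+ k @[t --> +oo] --> L * (k == n)%:R.
Proof.
move=> kn fL.
have V : (t / 2)^-1 @[t --> +oo] --> (0 : R).
  apply/gtr0_cvgV0.
    by near=> t; rewrite divr_gt0//; near: t; exact: nbhs_pinfty_gt (num_real _).
  apply/cvgryPge => A; near=> t; suff : A * 2 <= t by rewrite ler_pdivlMr.
  by near: t; exact: nbhs_pinfty_ge (num_real _).
have VX : (t / 2)^-1 ^+ (n - k) @[t --> +oo] --> ((k == n)%:R : R).
  have -> : (k == n)%:R = 0 ^+ (n - k) :> R.
    by rewrite expr0n subn_eq0 eqn_leq kn.
  apply: (cvg_comp (fun t => (t / 2)^-1) (fun x => x ^+ (n - k)) V).
  exact: exprn_continuous.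
apply: (@cvg_trans _ (f t * (t / 2) ^+ n * (t / 2)^-1 ^+ (n - k) @[t --> +oo])).
  apply: near_eq_cvg; near=> t.
  have t0 : 0 < t / 2.
    by rewrite divr_gt0//; near: t; exact: nbhs_pinfty_gt (num_real _).
  rewrite -{1}(subnKC kn) exprD exprVn mulrA mulfK// expf_neq0// gt_eqF//.
exact: cvgM.
Unshelve. all: by end_near. Qed.

Lemma asymp_equiv_pow (f : R -> R) n (L : R) : L != 0 ->
  f t * (t / 2) ^+ n @[t --> +oo] --> L ->
  asymp_equiv f (fun t => L * 2 ^+ n * t ^- n).
Proof.
move=> L0 fL; rewrite /asymp_equiv.
apply: (@cvg_trans _ (f t * (t / 2) ^+ n * L^-1 @[t --> +oo])).
  apply: near_eq_cvg; near=> t.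
  have t0 : 0 < t by near: t; exact: nbhs_pinfty_gt (num_real _).
  rewrite expr_div_n; field.
  by rewrite L0 !expf_neq0// gt_eqF.
have h : f t * (t / 2) ^+ n * L^-1 @[t --> +oo] --> L / L by exact: cvgMl.
 rewrite mulfV // in h; exact: h.
Unshelve. all: by end_near. Qed.

Lemma asymp_equiv_mean N (c : R -> 'I_N.+1 -> R) (lambda : R) : 0 < lambda ->
  (1 <= N)%N ->
  (forall n : 'I_N.+1,
    c t n * (t / 2) ^+ n @[t --> +oo] --> (N`!%:R / (N - n)`!%:R : R)) ->
  asymp_equiv (fun t => lambda^-1 * \sum_(n < N.+1) c t n * n%:R)
    (fun t => 2 * N%:R * lambda^-1 * t^-1).
Proof.
move=> l0 N0 hc.
have NR0 : N%:R != 0 :> R by rewrite pnatr_eq0 -lt0n.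
have lim : \sum_(n < N.+1) c t n * (t / 2) ^+ 1 * n%:R @[t --> +oo] --> (N%:R : R).
  have -> : N%:R = \sum_(n < N.+1) (if n == 1%N :> nat then N%:R else 0) :> R.
    have N1 : (1 < N.+1)%N by [].
    rewrite (bigD1 (Ordinal N1))//= big1 ?addr0// => i.
    by rewrite -val_eqE /= => /negbTE ->.
  apply: (@cvg_fsum R R _ _ _ (fun (n : 'I_N.+1) t => c t n * (t / 2) ^+ 1 * n%:R)
    (fun n : 'I_N.+1 => if n == 1%N :> nat then N%:R else 0)) => n.
  have [n0|n0] := posnP n.
    rewrite n0/=; under eq_cvg do rewrite mulr0; exact: cvg_cst.
  have := cvg_scaled_pow n0 (hc n); rewrite [1%N == _]eq_sym => h.
  have -> : (if n == 1%N :> nat then N%:R else 0) =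
      N`!%:R / (N - n)`!%:R * (n == 1%N :> nat)%:R * n%:R :> R.
    case: eqP => [->|]; last by rewrite mulr0 mul0r.
    case: (N) N0 => // N' _; rewrite subn1 /= factS natrM; field.
    exact: fact_neq0.
  exact: cvgMl.
apply: (@cvg_trans _ ((\sum_(n < N.+1) c t n * (t / 2) ^+ 1 * n%:R) / N%:R @[t --> +oo])).
  apply: near_eq_cvg; near=> t.
  have t0 : 0 < t by near: t; exact: nbhs_pinfty_gt (num_real _).
  have -> : \sum_(n < N.+1) c t n * (t / 2) ^+ 1 * n%:R =
      (t / 2) * \sum_(n < N.+1) c t n * n%:R.
    by rewrite mulr_sumr; apply: eq_bigr => n _; rewrite expr1; ring.
  by field; rewrite NR0 !gt_eqF.
have h : (\sum_(n < N.+1) c t n * (t / 2) ^+ 1 * n%:R) / N%:R @[t --> +oo] -->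
    (N%:R / N%:R : R) by exact: cvgMl.
 rewrite mulfV // in h; exact: h.
Unshelve. all: by end_near. Qed.

Lemma asymp_equiv_trans (f g h : R -> R) :
  (\forall t \near +oo, g t != 0) -> asymp_equiv f g -> asymp_equiv g h -> asymp_equiv f h.
Proof.
move=> g0 fg gh; rewrite /asymp_equiv -[X in _ --> X]mulr1.
apply: (@cvg_trans _ (f t / g t * (g t / h t) @[t --> +oo])); last exact: cvgM.
apply: near_eq_cvg; near=> t.
have gt0 : g t != 0 by near: t.
by rewrite mulrA divfK.
Unshelve. all: by end_near. Qed.

End Rates.

(** * The coefficients of a solution *)

Section Coefficients.
Context {R : realType}.
Local Notation mu := (@lebesgue_measure R).

Lemma solution_coefficients (lambda : R) (N : nat) (c0 : 'I_N.+1 -> R) (p : R -> R -> R) :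
  0 < lambda -> c0 ord_max <> 0 -> evol_solution p ->
  eq_L1 (p 0) (exp_poly lambda c0) ->
  exists c : R -> 'I_N.+1 -> R,
    [/\ forall n : 'I_N.+1, c 0 n = c0 n,
        forall t : R, 0 <= t -> eq_L1 (p t) (exp_poly lambda (c t)),
        forall t : R, 0 <= t -> \sum_(n < N.+1) c t n = 1 &
        forall n : 'I_N.+1,
          c t n * (t / 2) ^+ n @[t --> +oo] --> (N`!%:R / (N - n)`!%:R : R)].
Proof.
move=> l0 lead hp pinit.
have [E [r [E0 c0E cr dr pE]]] := solution_form l0 hp pinit.
pose a (j : nat) := ext0 (fun s => pairing (p s) (wexp lambda 1 j)).
pose c t (n : 'I_N.+1) := E t * r (N - n)%N t.
have [pP _] := hp.
have pL (t : R) : 0 <= t -> in_L1 (p t) by move=> /pP[].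
have pc (t : R) : 0 <= t -> eq_L1 (p t) (exp_poly lambda (c t)) by exact: pE.
have csum (t : R) : 0 <= t -> \sum_(n < N.+1) c t n = 1.
  move=> t0; rewrite -(Rintegral_exp_poly _ l0).
  rewrite -(eq_L1_Rintegral (in_L1_measurable (pL t t0))
    (in_L1_measurable (in_L1_exp_poly (c t) l0)) (pc t t0)).
  by have [_ _ p1] := pP t t0; rewrite /Rintegral p1.
have [delta delta0 hdelta] := @overlap_lower_bound R N.
have aE j (t : R) : 0 <= t -> a j t = pairing (p t) (wexp lambda 1 j).
  by move=> t0; rewrite /a ext0E.
have tw j := wexp_test j l0 (lexx (1 : R)).
exists c; split=> // n.
apply: (@coeff_asymptotics R N a E r delta) => //.
- by move=> j; exact: continuous_overlap hp.
- move=> j t t0; rewrite aE//; apply: le_trans (pairing_le (pL t t0) (tw j)) _.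
  by rewrite (prob_density_norm (pP t t0)) mul1r.
- move=> t t0; rewrite aE//.
  exact: hdelta l0 (pP t t0) (pc t t0) (csum t t0).
- move: lead; rewrite -c0E /= subnn => /eqP; rewrite mulf_eq0 negb_or.
  by case/andP.
- move=> t t0; rewrite aE// (pairing_wexp1 l0 (lexx (1 : R)) (pL t t0) (pc t t0)).
  by apply: eq_bigr.
- by rewrite -ltnS.
Qed.

End Coefficients.

(** * The decay theorem *)

Theorem mainTheorem1 (R : realType) (lambda : R) (hlambda : 0 < lambda)
    (N : nat) (hN : (1 <= N)%N)
    (c0 : 'I_N.+1 -> R)
    (hsum : \sum_(n < N.+1) c0 n = 1)
    (hlead : c0 ord_max <> 0)
    (hnonneg : forall x : R, 0 < x -> 0 <= exp_poly lambda c0 x)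
    (p : R -> R -> R)
    (hp : evol_solution p)
    (hinit : eq_L1 (p 0) (exp_poly lambda c0)) :
  (exists c : R -> 'I_N.+1 -> R,
    [/\ forall n : 'I_N.+1, c 0 n = c0 n,
        forall tau : R, 0 <= tau ->
          eq_L1 (p tau) (exp_poly lambda (c tau)) /\
          \sum_(n < N.+1) c tau n = 1 &
        forall n : 'I_N.+1, (1 <= n)%N ->
          asymp_equiv (fun tau => c tau n)
            (fun tau => (N`!)%:R / ((N - n)`!)%:R * 2 ^+ n * tau ^- n)]) /\
  (forall q : R -> R -> R,
    (forall tau : R, 0 <= tau -> continuous_rep (p tau) (q tau)) ->
    forall x : R, 0 < x ->
      q tau x @[tau --> +oo] --> lambda * expR (- (lambda * x))) /\
  [/\ asymp_equiv (fun tau => mean (p tau) - lambda^-1)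
        (fun tau => 2 * N%:R * lambda^-1 * tau^-1),
      asymp_equiv (fun t => 2 * N%:R * lambda^-1 * (ln (1 + t))^-1)
        (fun t => 2 * N%:R * lambda^-1 * (ln t)^-1) &
      asymp_equiv (fun t => mean (p (ln (1 + t))) - lambda^-1)
        (fun t => 2 * N%:R * lambda^-1 * (ln t)^-1)].
Proof.
have [c [c_init pc csum climit]] := solution_coefficients hlambda hlead hp hinit.
have [pP _] := hp.
have pL (t : R) : 0 <= t -> in_L1 (p t) by move=> /pP[].
have K0 : 2 * N%:R * lambda^-1 != 0.
  by rewrite !mulf_neq0// ?invr_neq0 ?gt_eqF// ltr0n.
have mean_rate : asymp_equiv (fun tau => mean (p tau) - lambda^-1)
    (fun tau => 2 * N%:R * lambda^-1 * tau^-1).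
  apply: cvg_trans (asymp_equiv_mean hlambda hN climit).
  apply: near_eq_cvg; near=> t.
  have t0 : 0 <= t by near: t; exact: nbhs_pinfty_ge (num_real _).
  rewrite (mean_exp_poly hlambda (pL t t0) (pc t t0)).
  congr (_ / _); rewrite -[X in _ = _ - X]mulr1 -mulrBr; congr (_ * _).
  rewrite -[X in _ = _ - X](csum t t0) -sumrB; apply: eq_bigr => n _.
  by rewrite -natr1; ring.
split; last split.
- exists c; split=> // [tau tau0|n n0]; first by split; [exact: pc|exact: csum].
  apply: asymp_equiv_pow; last exact: climit.
  by rewrite mulf_neq0 ?invr_neq0 ?fact_neq0.
- move=> q hq x x0.
  apply: cvg_trans (@cvg_exp_poly R lambda N c x _); last first.
    move=> n; have := cvg_scaled_pow (leq0n n) (climit n).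
    under eq_cvg do rewrite expr0 mulr1.
    rewrite eq_sym; case: eqP => [->|_]; last by rewrite mulr0.
    by rewrite subn0 mulr1 divff ?fact_neq0.
  apply: near_eq_cvg; near=> t.
  have t0 : 0 <= t by near: t; exact: nbhs_pinfty_ge (num_real _).
  have [cq pq] := hq t t0.
  apply: (@eq_L1_continuous R (exp_poly lambda (c t)) (q t)) => //.
  + exact: eq_L1_euclid (pc t t0) pq.
  + by move=> y _; exact: continuous_exp_poly.
  + by rewrite half_lineE.
- split=> //; first exact: asymp_equiv_ln.
  apply: asymp_equiv_trans (asymp_equiv_ln K0).
    near=> t; rewrite mulf_neq0// invr_neq0// gt_eqF// ln_gt0// ltrDl.
    by near: t; exact: nbhs_pinfty_gt (num_real _).
  exact: (cvg_comp (fun t => ln (1 + t)) _ cvg_ln1D_infty mean_rate).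
Unshelve. all: by end_near. Qed.
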